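(* Let $\mathbb{K}\in\{\mathbb{R},\mathbb{C}\}$ and let $\Sigma=(E,A,B,C,D)$ be a linear time-invariant descriptor system over $\mathbb{K}$ with $(E,A)$ regular. Then, with the properties (pH), (KYP), (Pa), (PR) defined in the context: 1. (pH) $\Rightarrow$ (KYP), and (KYP) $\Rightarrow$ both (PR) and (Pa). 2. Every $Q\in\mathbb{K}^{n\times n}$ for which (pH) is fulfilled is a solution of (KYP), and for every solution $Q$ of (KYP) the function $\mathcal{S}(x)=\tfrac12 x^HQ^HEx$ is a storage function in (Pa). 3. If (KYP) has an invertible solution $Q$, then (pH) holds. 4. If (Pa) holds and $E$ is invertible, then (KYP) holds.
   Context: A descriptor system $\Sigma=(E,A,B,C,D)$ over $\mathbb{K}$ is given by $E,A\in\mathbb{K}^{n\times n}$, $B\in\mathbb{K}^{n\times m}$, $C\in\mathbb{K}^{m\times n}$, $D\in\mathbb{K}^{m\times m}$ and stands for $$\tfrac{d}{dt}Ex(t)=Ax(t)+Bu(t),\quad x(0)=x_0,\qquad y(t)=Cx(t)+Du(t). \quad ( * )$$ $(E,A)$ is regular if $\lambda E-A$ is invertible for some $\lambda\in\mathbb{C}$. $M^H$ is the conjugate transpose; $M\ge 0$ means Hermitian positive semidefinite. The transfer function is $\mathcal{T}(s)=C(sE-A)^{-1}B+D$. (pH): there exist $J,R,Q\in\mathbb{K}^{n\times n}$, $G,P\in\mathbb{K}^{n\times m}$, $S,N\in\mathbb{K}^{m\times m}$ with $$\begin{bmatrix}A&B\\C&D\end{bmatrix}=\begin{bmatrix}(J-R)Q&G-P\\(G+P)^HQ&S+N\end{bmatrix},\quad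 Q^HE=E^HQ\ge 0,$$ $$\Gamma:=\begin{bmatrix}J&G\\-G^H&N\end{bmatrix}=-\Gamma^H,\quad W:=\begin{bmatrix}Q^HRQ&Q^HP\\P^HQ&S\end{bmatrix}=W^H\ge 0.$$ (KYP): there is a solution $Q\in\mathbb{K}^{n\times n}$ of $$\begin{bmatrix}-A^HQ-Q^HA&C^H-Q^HB\\C-B^HQ&D+D^H\end{bmatrix}\ge 0,\qquad E^HQ=Q^HE\ge 0.$$ (Pa) (passivity): there is $Q\in\mathbb{K}^{n\times n}$ such that $\mathcal{S}(x)=\tfrac12x^HQ^HEx$ (called a storage function) satisfies, for all $T\ge 0$, $$\mathcal{S}(x(T))-\mathcal{S}(x(0))\le\int_0^T\operatorname{Re}\,y(\tau)^Hu(\tau)\,d\tau,\qquad \mathcal{S}(x(T))\ge 0,$$ for all consistent initial values $x_0$ and all infinitely differentiable functions $x,u,y$ fulfilling $( * )$ with $x(0)=x_0$. (An initial value $x_0$ is consistent if such a solution exists.) (PR) (positive real): $\mathcal{T}$ has no poles in $\{s\in\mathbb{C}:\operatorname{Re}s>0\}$ and $\mathcal{T}(s)+\mathcal{T}(s)^H\ge 0$ for all $s\in\mathbb{C}$ with $\operatorname{Re}s>0$. *)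

(* Defs.v *)
From HB Require Import structures.
From mathcomp Require Import all_boot all_order all_algebra.
From mathcomp Require Import generic_quotient.
From mathcomp Require Import complex.
From mathcomp Require Import all_classical all_reals all_analysis.

Set Implicit Arguments.
Unset Strict Implicit.
Unset Printing Implicit Defensive.

Import Order.TTheory GRing.Theory Num.Theory.
Import numFieldNormedType.Exports.

Local Open Scope sesquilinear_scope.
Local Open Scope classical_set_scope.
Local Open Scope complex_scope.
Local Open Scope ring_scope.

Local Notation "x %:F" := (FracField.tofrac x).

(* All matrices and signals have entries in R[i], the complex numbers over
   R : realType; the base field, real or complex, is a subset of R[i] and
   "over K" means that all entries lie in that subset.

   The order on R[i] is the partial order of Num: a <= b means that b - a is
   real and nonnegative.  M^t* is the conjugate transpose. *)
Variant scalar_field := RealScalars | ComplexScalars.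

Definition scalars (R : realType) (K : scalar_field) : {pred R[i]} :=
  match K with
  | RealScalars => [pred z | z \is Num.real]
  | ComplexScalars => predT
  end.

Definition mx_over (R : realType) (K : scalar_field) m n (M : 'M[R[i]]_(m, n)) :=
  forall i j, M i j \in scalars K.

(* For M with real entries, testing on complex vectors is equivalent to testing
   on real ones, because M is required to be Hermitian. *)
Definition psdmx (R : realType) n (M : 'M[R[i]]_n) : Prop :=
  M^t* = M /\ forall v : 'cV[R[i]]_n, 0 <= (v^t* *m M *m v) 0 0.

Record descriptor_system (R : realType) (n m : nat) := DescriptorSystem {
  ds_E : 'M[R[i]]_n;
  ds_A : 'M[R[i]]_n;
  ds_B : 'M[R[i]]_(n, m);
  ds_C : 'M[R[i]]_(m, n);
  ds_D : 'M[R[i]]_m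
}.

Definition system_over (R : realType) (K : scalar_field) n m
    (Sys : descriptor_system R n m) : Prop :=
  let: DescriptorSystem E A B C D := Sys in
  [/\ mx_over K E, mx_over K A, mx_over K B, mx_over K C & mx_over K D].

Definition regular_pencil (R : realType) n (E A : 'M[R[i]]_n) : Prop :=
  exists lambda : R[i], lambda *: E - A \in unitmx.

Definition pH_with (R : realType) (K : scalar_field) n m
    (Sys : descriptor_system R n m) (Q : 'M[R[i]]_n) : Prop :=
  let: DescriptorSystem E A B C D := Sys in
  exists (J Rm : 'M[R[i]]_n) (G P : 'M[R[i]]_(n, m)) (S N : 'M[R[i]]_m),
    let Gamma := block_mx J G (- G^t*) N in
    let W := block_mx (Q^t* *m Rm *m Q) (Q^t* *m P) (P^t* *m Q) S in
    [/\ [/\ mx_over K J, mx_over K Rm & mx_over K Q],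
        [/\ mx_over K G, mx_over K P, mx_over K S & mx_over K N],
        block_mx A B C D =
          block_mx ((J - Rm) *m Q) (G - P) ((G + P)^t* *m Q) (S + N),
        Q^t* *m E = E^t* *m Q /\ psdmx (Q^t* *m E)
      & Gamma = - Gamma^t* /\ psdmx W].

Definition pH (R : realType) (K : scalar_field) n m
    (Sys : descriptor_system R n m) : Prop :=
  exists Q, pH_with K Sys Q.

Definition KYP_solution (R : realType) (K : scalar_field) n m
    (Sys : descriptor_system R n m) (Q : 'M[R[i]]_n) : Prop :=
  let: DescriptorSystem E A B C D := Sys in
  [/\ mx_over K Q,
      psdmx (block_mx (- (A^t* *m Q) - Q^t* *m A) (C^t* - Q^t* *m B)
                      (C - B^t* *m Q)             (D + D^t*)),
      E^t* *m Q = Q^t* *m E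
    & psdmx (E^t* *m Q)].

Definition KYP (R : realType) (K : scalar_field) n m
    (Sys : descriptor_system R n m) : Prop :=
  exists Q, KYP_solution K Sys Q.

(* Signals live on the time axis [0, +oo[: only their values at t >= 0 matter,
   and the derivative at t = 0 is one-sided. *)
Definition derivative_on_halfline (R : realType) (f g : R -> R) : Prop :=
  forall t : R, 0 <= t ->
    h^-1 * (f (t + h) - f t) @[h --> within [set h | 0 <= t + h] 0^'] --> g t.

Definition mx_derivative (R : realType) m n (F G : R -> 'M[R[i]]_(m, n)) : Prop :=
  forall i j,
    derivative_on_halfline (fun t => complex.Re (F t i j))
                           (fun t => complex.Re (G t i j)) /\
    derivative_on_halfline (fun t => complex.Im (F t i j))
                           (fun t => complex.Im (G t i j)).

Definition smooth (R : realType) m n (F : R -> 'M[R[i]]_(m, n)) : Prop :=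
  exists d : nat -> R -> 'M[R[i]]_(m, n),
    d 0%N = F /\ forall k, mx_derivative (d k) (d k.+1).

Definition smooth_solution (R : realType) (K : scalar_field) n m
    (Sys : descriptor_system R n m) (x0 : 'cV[R[i]]_n)
    (x : R -> 'cV[R[i]]_n) (u y : R -> 'cV[R[i]]_m) : Prop :=
  let: DescriptorSystem E A B C D := Sys in
  [/\ forall t : R, 0 <= t -> [/\ mx_over K (x t), mx_over K (u t) & mx_over K (y t)],
      [/\ smooth x, smooth u & smooth y],
      mx_derivative (fun t => E *m x t) (fun t => A *m x t + B *m u t),
      x 0 = x0
    & forall t : R, 0 <= t -> y t = C *m x t + D *m u t].

Definition consistent (R : realType) (K : scalar_field) n m
    (Sys : descriptor_system R n m) (x0 : 'cV[R[i]]_n) : Prop :=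
  exists x u y, smooth_solution K Sys x0 x u y.

Definition supplied_energy (R : realType) m (u y : R -> 'cV[R[i]]_m) (T : R) : R :=
  \int[@lebesgue_measure R]_(t in `[0, T])
    complex.Re (((y t)^t* *m u t) 0 0).

Definition storage_function (R : realType) (K : scalar_field) n m
    (Sys : descriptor_system R n m) (S : 'cV[R[i]]_n -> R[i]) : Prop :=
  forall x0, consistent K Sys x0 ->
  forall x u y, smooth_solution K Sys x0 x u y ->
  forall T : R, 0 <= T ->
    S (x T) - S (x 0) <= (supplied_energy u y T)%:C /\ 0 <= S (x T).

Definition quadratic_storage (R : realType) n m
    (Sys : descriptor_system R n m) (Q : 'M[R[i]]_n) (x : 'cV[R[i]]_n) : R[i] :=
  2^-1 * (x^t* *m Q^t* *m ds_E Sys *m x) 0 0.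

Definition passive (R : realType) (K : scalar_field) n m
    (Sys : descriptor_system R n m) : Prop :=
  exists Q, mx_over K Q /\ storage_function K Sys (quadratic_storage Sys Q).

(* A rational function is an element of the fraction field of polynomials; its
   poles and its values are read off a representative in lowest terms, so that
   common zeros of numerator and denominator are cancelled.  The value at a
   pole is meaningless. *)
Definition ratnum (F : fieldType) (f : {fraction {poly F}}) : {poly F} :=
  let r := generic_quotient.repr f in r.1 %/ gcdp r.1 r.2.

Definition ratden (F : fieldType) (f : {fraction {poly F}}) : {poly F} :=
  let r := generic_quotient.repr f in r.2 %/ gcdp r.1 r.2.

Definition pole (F : fieldType) (f : {fraction {poly F}}) (s : F) : bool :=
  root (ratden f) s.

Definition rateval (F : fieldType) (s : F) (f : {fraction {poly F}}) : F :=
  (ratnum f).[s] / (ratden f).[s].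

Definition ratmx (F : fieldType) m n (M : 'M[F]_(m, n)) :
    'M[{fraction {poly F}}]_(m, n) :=
  map_mx (fun a => (a%:P)%:F) M.

Definition transfer_function (R : realType) n m (Sys : descriptor_system R n m) :
    'M[{fraction {poly R[i]}}]_m :=
  let: DescriptorSystem E A B C D := Sys in
  ratmx C *m invmx ('X%:F *: ratmx E - ratmx A) *m ratmx B + ratmx D.

Definition positive_real (R : realType) n m (Sys : descriptor_system R n m) : Prop :=
  let T := transfer_function Sys in
  (forall s : R[i], 0 < complex.Re s -> forall i j, ~~ pole (T i j) s) /\
  (forall s : R[i], 0 < complex.Re s ->
     let Ts := map_mx (rateval s) T in psdmx (Ts + Ts^t*)).

(* Main.v *)
(* (pH) => (KYP): the matrix of (KYP) is twice W; conversely, an invertible Q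
   lets one solve the equations of (pH) for J, R, G, P, S and N.

   (KYP) => (Pa): along a solution, the quadratic form of the (KYP) matrix at
   (x, u) is twice the supplied power minus the growth rate of the storage
   function; integrate.

   (KYP) => (PR): evaluating the same form at x = (sE - A)^-1 B u shows that
   T(s) + T(s)^H is positive semidefinite wherever sE - A is invertible.  The
   zeros of det(sE - A) in the right half-plane are not poles: near a pole of
   order k the leading term c / (s - s0)^k takes every direction of the complex
   plane as s circles s0, so its real part would become negative.

   (Pa) => (KYP) for invertible E: every pair (x0, u0) starts a smooth solution,
   and dividing the dissipation inequality on [0, T] by T and letting T tend to
   0 gives the quadratic form inequality at (x0, u0). *)

Require Import Defs.
From mathcomp Require Import all_boot all_order all_algebra.
From mathcomp Require Import complex.
From mathcomp Require Import all_classical all_reals all_analysis.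
From mathcomp Require Import ring lra.
Set Implicit Arguments.
Unset Strict Implicit.
Unset Printing Implicit Defensive.

Import Order.TTheory GRing.Theory Num.Theory.
Import numFieldNormedType.Exports.

Local Open Scope sesquilinear_scope.
Local Open Scope classical_set_scope.
Local Open Scope complex_scope.
Local Open Scope ring_scope.

(** * Conjugate transposes, base fields and the algebra of (KYP) *)

Section Adjoint.
Variable C : numClosedFieldType.

Lemma adjmxD m n (A B : 'M[C]_(m, n)) : (A + B)^t* = A^t* + B^t*.
Proof. by rewrite linearD map_mxD. Qed.

Lemma adjmxN m n (A : 'M[C]_(m, n)) : (- A)^t* = - A^t*.
Proof. by rewrite linearN map_mxN. Qed.

Lemma adjmxM m n p (A : 'M[C]_(m, n)) (B : 'M[C]_(n, p)) :
  (A *m B)^t* = B^t* *m A^t*.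
Proof. by rewrite trmx_mul map_mxM. Qed.

Lemma adjmxZ m n a (A : 'M[C]_(m, n)) : (a *: A)^t* = a^* *: A^t*.
Proof. by rewrite linearZ map_mxZ. Qed.

Lemma adjmx_inv n (A : 'M[C]_n) : (invmx A)^t* = invmx (A^t*).
Proof. by rewrite trmx_inv map_invmx. Qed.

Lemma adjmx_block m1 m2 n1 n2 (A : 'M[C]_(m1, n1)) (B : 'M[C]_(m1, n2))
    (D : 'M[C]_(m2, n1)) (F : 'M[C]_(m2, n2)) :
  (block_mx A B D F)^t* = block_mx (A^t*) (D^t*) (B^t*) (F^t*).
Proof. by rewrite tr_block_mx map_block_mx. Qed.

Lemma adjmx_unit n (A : 'M[C]_n) : (A^t* \in unitmx) = (A \in unitmx).
Proof. by rewrite map_unitmx unitmx_tr. Qed.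

Lemma conj_half : (2^-1 : C)^* = 2^-1.
Proof. by rewrite fmorphV rmorph_nat. Qed.

Definition adjmxE := (adjmxD, adjmxN, adjmxM, adjmxZ, adjmx_inv, adjmx_block,
  @trmxCK, conj_half).

Lemma mx11D (A B : 'M[C]_1) : (A + B) 0 0 = A 0 0 + B 0 0.
Proof. by rewrite mxE. Qed.

Lemma mx11N (A : 'M[C]_1) : (- A) 0 0 = - A 0 0.
Proof. by rewrite mxE. Qed.

Lemma mx11Z a (A : 'M[C]_1) : (a *: A) 0 0 = a * A 0 0.
Proof. by rewrite mxE. Qed.

Lemma mx11_adj (A : 'M[C]_1) : (A^t*) 0 0 = (A 0 0)^*.
Proof. by rewrite !mxE. Qed.

Definition mx11E := (mx11D, mx11N, mx11Z, mx11_adj).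

Lemma double_mx m n (A : 'M[C]_(m, n)) : 2 *: A = A + A.
Proof. by rewrite scaler_nat mulr2n. Qed.

Lemma half_double m n (A : 'M[C]_(m, n)) : 2^-1 *: A + 2^-1 *: A = A.
Proof. by rewrite -scalerDl -[X in X + X]mul1r -splitr scale1r. Qed.

Section KYPMatrix.
Variables n m : nat.
Implicit Types (A J Rm Q : 'M[C]_n) (B G P : 'M[C]_(n, m)).
Implicit Types (Co : 'M[C]_(m, n)) (D S N : 'M[C]_m).

Definition KYP_mx A B Co D Q :=
  block_mx (- (A^t* *m Q) - Q^t* *m A) (Co^t* - Q^t* *m B)
           (Co - B^t* *m Q)            (D + D^t*).

(** Adding the conjugate transpose cancels the skew-Hermitian [J] and [N] and doubles the
    dissipative part; off the diagonal it is [G] that cancels. Symmetry is assumed of Q^H R Q rather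
    than of R, because (pH) yields no more when [Q] is singular. *)
Lemma KYP_mx_pH J Rm Q G P S N :
  J^t* = - J -> N^t* = - N -> S^t* = S ->
  Q^t* *m (Rm^t* *m Q) = Q^t* *m Rm *m Q ->
  KYP_mx ((J - Rm) *m Q) (G - P) ((G + P)^t* *m Q) (S + N) Q =
  2 *: block_mx (Q^t* *m Rm *m Q) (Q^t* *m P) (P^t* *m Q) S.
Proof.
move=> hJ hN hS; rewrite mulmxA => hR.
rewrite /KYP_mx !adjmxE scale_block_mx; congr block_mx; rewrite double_mx.
- rewrite hJ mulmxDr mulmxDl mulmxDl mulmxDr !mulmxN !mulNmx !mulmxN !mulmxA hR.
  by rewrite !opprD !opprK addrACA subrr add0r.
- by rewrite !mulmxDr mulmxN opprD opprK addrACA subrr add0r.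
- by rewrite !mulmxDl mulNmx opprD opprK addrACA subrr add0r.
- by rewrite hS hN addrACA subrr addr0.
Qed.

Lemma pH_skew_blocks J G N :
  block_mx J G (- G^t*) N = - (block_mx J G (- G^t*) N)^t* ->
  J^t* = - J /\ N^t* = - N.
Proof.
rewrite !adjmxE opp_block_mx => /eq_block_mx[hJ _ _ hN].
by split; rewrite [in RHS](hJ, hN) opprK.
Qed.

Lemma pH_hermitian_blocks Rm Q P S :
  let W := block_mx (Q^t* *m Rm *m Q) (Q^t* *m P) (P^t* *m Q) S in
  W^t* = W -> Q^t* *m (Rm^t* *m Q) = Q^t* *m Rm *m Q /\ S^t* = S.
Proof. by rewrite /= !adjmxE => /eq_block_mx[]. Qed.

(** The blocks require J - R = A Q^-1 = F, G - P = B and G + P = Q^-H C^H = H. So J and -R are the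
    skew-Hermitian and Hermitian parts of F, G and P the half sum and half difference of H and B,
    and N and S the two parts of D. *)
Lemma pH_system_mx A B Co D Q : Q \in unitmx ->
  let F := A *m invmx Q in let H := invmx (Q^t*) *m Co^t* in
  block_mx A B Co D =
  block_mx ((2^-1 *: (F - F^t*) - 2^-1 *: (- F - F^t*)) *m Q)
           (2^-1 *: (H + B) - 2^-1 *: (H - B))
           ((2^-1 *: (H + B) + 2^-1 *: (H - B))^t* *m Q)
           (2^-1 *: (D + D^t*) + 2^-1 *: (D - D^t*)).
Proof.
move=> uQ F H; congr block_mx.
- rewrite -scalerBr opprD !opprK addrACA addNr addr0 scalerDr half_double.
  by rewrite mulmxKV.
- by rewrite -scalerBr opprD opprK addrACA subrr add0r scalerDr half_double.
- rewrite -scalerDr addrACA subrr addr0 scalerDr half_double.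
  by rewrite !adjmxE mulmxKV.
- by rewrite -scalerDr addrACA subrr addr0 scalerDr half_double.
Qed.

Lemma pH_structure_mx_skew A B Co D Q :
  let F := A *m invmx Q in let H := invmx (Q^t*) *m Co^t* in
  let Gamma := block_mx (2^-1 *: (F - F^t*)) (2^-1 *: (H + B))
                (- (2^-1 *: (H + B))^t*) (2^-1 *: (D - D^t*)) in
  Gamma = - Gamma^t*.
Proof.
move=> F H Gamma; rewrite /Gamma adjmx_block opp_block_mx.
rewrite !(adjmxN, trmxCK) opprK; congr block_mx.
- by rewrite adjmxZ conj_half -scalerN adjmxD adjmxN trmxCK opprB.
- by rewrite adjmxZ conj_half -scalerN adjmxD adjmxN trmxCK opprB.
Qed.

(** Multiplying by Q^H and Q undoes the inverses in F and H, so [W] inherits semidefiniteness from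
    the (KYP) matrix. *)
Lemma pH_dissipation_mx A B Co D Q : Q \in unitmx ->
  let F := A *m invmx Q in let H := invmx (Q^t*) *m Co^t* in
  block_mx (Q^t* *m (2^-1 *: (- F - F^t*)) *m Q) (Q^t* *m (2^-1 *: (H - B)))
    ((2^-1 *: (H - B))^t* *m Q) (2^-1 *: (D + D^t*)) =
  2^-1 *: KYP_mx A B Co D Q.
Proof.
move=> uQ F H; have uQ' : Q^t* \in unitmx by rewrite adjmx_unit.
have FQ : F *m Q = A by rewrite mulmxKV.
have QF : Q^t* *m F^t* = A^t* by rewrite -adjmxM FQ.
have QH : Q^t* *m H = Co^t* by rewrite mulKVmx.
have HQ : H^t* *m Q = Co by rewrite !adjmxE mulmxKV.
rewrite scale_block_mx; congr block_mx.
- rewrite -scalemxAr -scalemxAl mulmxDr mulmxDl !mulmxN !mulNmx QF -mulmxA FQ.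
  by rewrite addrC.
- by rewrite -scalemxAr mulmxDr mulmxN QH.
- by rewrite adjmxZ conj_half adjmxD adjmxN -scalemxAl mulmxDl mulNmx HQ.
Qed.

(* Re z is the supplied power and Re w the growth rate of the storage function. *)
Lemma KYP_mx_form A B Co D Q (x : 'cV[C]_n) (v : 'cV[C]_m) :
  let z := (v^t* *m (Co *m x + D *m v)) 0 0 in
  let w := (x^t* *m Q^t* *m (A *m x + B *m v)) 0 0 in
  ((col_mx x v)^t* *m KYP_mx A B Co D Q *m col_mx x v) 0 0 =
  (z + z^*) - (w + w^*).
Proof.
rewrite /= tr_col_mx map_row_mx /KYP_mx mul_row_block mul_row_col.
rewrite -!mx11_adj !adjmxE !(mulmxDl, mulmxDr, mulNmx, mulmxN) !mulmxA.
rewrite !mx11E; ring.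
Qed.

End KYPMatrix.

End Adjoint.


Section BaseField.
Variables (R : realType) (K : scalar_field).

(** Being over K becomes invariance under entrywise conjugation (no condition in the complex case),
    so the closure properties below follow from conjugation being a ring morphism. *)
Lemma mx_over_conj m n (M : 'M[R[i]]_(m, n)) :
  mx_over K M <-> (K = RealScalars -> map_mx Num.conj M = M).
Proof.
case: K; rewrite /mx_over /=; split => // h.
- by move=> _; apply/matrixP => i j; rewrite mxE; apply/CrealP/h.
- by move=> i j; apply/CrealP; move/matrixP: (h erefl) => /(_ i j); rewrite mxE.
Qed.

Lemma mx_overD m n (A B : 'M[R[i]]_(m, n)) :
  mx_over K A -> mx_over K B -> mx_over K (A + B).
Proof.
rewrite !mx_over_conj => hA hB e.
by rewrite map_mxD hA ?hB.
Qed.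

Lemma mx_overN m n (A : 'M[R[i]]_(m, n)) : mx_over K A -> mx_over K (- A).
Proof. by rewrite !mx_over_conj => hA e; rewrite map_mxN hA. Qed.

Lemma mx_overM m n p (A : 'M[R[i]]_(m, n)) (B : 'M[R[i]]_(n, p)) :
  mx_over K A -> mx_over K B -> mx_over K (A *m B).
Proof.
rewrite !mx_over_conj => hA hB e.
by rewrite map_mxM hA ?hB.
Qed.

Lemma mx_over_adj m n (A : 'M[R[i]]_(m, n)) : mx_over K A -> mx_over K (A^t*).
Proof. by rewrite !mx_over_conj => hA e; rewrite -!map_trmx !hA. Qed.

Lemma mx_over_inv n (A : 'M[R[i]]_n) : mx_over K A -> mx_over K (invmx A).
Proof. by rewrite !mx_over_conj => hA e; rewrite map_invmx hA. Qed.

Lemma mx_over_half m n (A : 'M[R[i]]_(m, n)) :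
  mx_over K A -> mx_over K (2^-1 *: A).
Proof. by rewrite !mx_over_conj => hA e; rewrite map_mxZ hA //= conj_half. Qed.

Lemma mx_over0 m n : mx_over K (0 : 'M[R[i]]_(m, n)).
Proof. by rewrite mx_over_conj => e; rewrite map_mx0. Qed.

Lemma mx_over_block m1 m2 n1 n2 (A : 'M[R[i]]_(m1, n1)) (B : 'M[R[i]]_(m1, n2))
    (D : 'M[R[i]]_(m2, n1)) (F : 'M[R[i]]_(m2, n2)) :
  mx_over K A -> mx_over K B -> mx_over K D -> mx_over K F ->
  mx_over K (block_mx A B D F).
Proof.
rewrite !mx_over_conj => hA hB hD hF e.
by rewrite map_block_mx hA // hB // hD // hF.
Qed.

Lemma mx_over_col m1 m2 n (A : 'M[R[i]]_(m1, n)) (B : 'M[R[i]]_(m2, n)) :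
  mx_over K A -> mx_over K B -> mx_over K (col_mx A B).
Proof. by rewrite !mx_over_conj => hA hB e; rewrite map_col_mx hA ?hB. Qed.

Lemma mx_over_usub m1 m2 n (A : 'M[R[i]]_(m1 + m2, n)) :
  mx_over K A -> mx_over K (usubmx A).
Proof. by rewrite !mx_over_conj => hA e; rewrite map_usubmx hA. Qed.

Lemma mx_over_dsub m1 m2 n (A : 'M[R[i]]_(m1 + m2, n)) :
  mx_over K A -> mx_over K (dsubmx A).
Proof. by rewrite !mx_over_conj => hA e; rewrite map_dsubmx hA. Qed.

End BaseField.

(** * Positive semidefinite matrices *)

Section Semidefinite.
Variable R : realType.

Lemma psdmxZ n (a : R[i]) (M : 'M[R[i]]_n) : 0 <= a -> psdmx M -> psdmx (a *: M).
Proof.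
move=> a0 [hM pM]; split => [|v].
  by rewrite adjmxZ hM (CrealP _) // ger0_real.
by rewrite -scalemxAr -scalemxAl mxE mulr_ge0.
Qed.

(* A complex vector x + iy contributes the real quadratic forms of x and of y:
   the cross terms cancel by symmetry. *)
Lemma psdmx_over K n (M : 'M[R[i]]_n) : mx_over K M -> M^t* = M ->
  (forall v : 'cV[R[i]]_n, mx_over K v -> 0 <= (v^t* *m M *m v) 0 0) -> psdmx M.
Proof.
case: K => [|_ hM pM]; last by split => // v; apply: pM.
move=> /mx_over_conj /(_ erefl) cM hM pM; split => // v.
have tM : M^T = M by rewrite -[in RHS]hM -map_trmx cM.
pose x : 'cV[R[i]]_n := map_mx (fun z => (complex.Re z)%:C) v.
pose y : 'cV[R[i]]_n := map_mx (fun z => (complex.Im z)%:C) v.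
have vE : v = x + 'i *: y.
  by apply/matrixP => i j; rewrite !mxE [LHS]complexE.
have rx : mx_over RealScalars x.
  by move=> i j; rewrite mxE /=; apply/complex_realP; eexists.
have ry : mx_over RealScalars y.
  by move=> i j; rewrite mxE /=; apply/complex_realP; eexists.
have ax : x^t* = x^T by move/mx_over_conj: rx => /(_ erefl); rewrite -map_trmx => ->.
have ay : y^t* = y^T by move/mx_over_conj: ry => /(_ erefl); rewrite -map_trmx => ->.
have sxy : x^T *m M *m y = y^T *m M *m x.
  apply/matrixP => i j; rewrite !ord1.
  have -> : (x^T *m M *m y) 0 0 = (x^T *m M *m y)^T 0 0 by rewrite [RHS]mxE.
  by rewrite !trmx_mul trmxK tM mulmxA.
have ci : ('i : R[i])^* = - 'i by exact: conjCi.
have -> : v^t* *m M *m v = x^t* *m M *m x + y^t* *m M *m y.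
  rewrite vE !adjmxE ax ay ci !mulmxDl !mulmxDr -!scalemxAl -!scalemxAr sxy.
  rewrite scalerA scaleNr mulNr -expr2 sqr_i opprK scale1r.
  by rewrite addrA addrK.
by rewrite mx11D addr_ge0 // pM.
Qed.

End Semidefinite.

(** * Port-Hamiltonian form and solutions of (KYP) *)

Section PortHamiltonian.
Variables (R : realType) (K : scalar_field) (n m : nat).

Lemma pH_with_KYP (Sys : descriptor_system R n m) Q :
  pH_with K Sys Q -> KYP_solution K Sys Q.
Proof.
case: Sys => E A B C D [J [Rm [G [P [S [N]]]]]].
case=> -[_ _ oQ] _ /eq_block_mx [-> -> -> ->] [QE pQE] [Gm pW].
have [hJ hN] := pH_skew_blocks Gm.
have [hR hS] := pH_hermitian_blocks pW.1.
split; [exact: oQ| |exact: esym|by rewrite -QE].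
have := KYP_mx_pH G P hJ hN hS hR; rewrite /KYP_mx => ->.
exact: psdmxZ.
Qed.

Lemma KYP_solution_pH_with (Sys : descriptor_system R n m) Q :
  system_over K Sys -> KYP_solution K Sys Q -> Q \in unitmx -> pH_with K Sys Q.
Proof.
case: Sys => E A B C D [oE oA oB oC oD] [oQ pM hE pE] uQ.
pose F := A *m invmx Q.
pose H := invmx (Q^t*) *m C^t*.
have oF : mx_over K F by apply: mx_overM => //; apply: mx_over_inv.
have oH : mx_over K H.
  by apply: mx_overM; [apply: mx_over_inv|]; apply: mx_over_adj.
have oD2 := mx_over_adj oD; have oF2 := mx_over_adj oF.
exists (2^-1 *: (F - F^t*)), (2^-1 *: (- F - F^t*)), (2^-1 *: (H + B)),
  (2^-1 *: (H - B)), (2^-1 *: (D + D^t*)), (2^-1 *: (D - D^t*)).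
split; [| | exact: pH_system_mx | | split].
- by split; rewrite ?oQ; do ?[apply: mx_over_half | apply: mx_overD | apply: mx_overN].
- by split; do ?[apply: mx_over_half | apply: mx_overD | apply: mx_overN].
- by split; [exact: esym | rewrite -hE].
- exact: (pH_structure_mx_skew A B C D Q).
- have E1 := pH_dissipation_mx A B C D uQ.
  by rewrite E1; apply: psdmxZ; rewrite ?invr_ge0.
Qed.

End PortHamiltonian.

(** * Positivity near a zero of the denominator *)

Section RightLimit.
Variable R : realType.

(** Continuity at 0 in explicit form: p = p(0) + X q, and |q| is bounded on [0, 1] by the sum [b] of
    the moduli of its coefficients. If Re p(0) were negative, p would still have negative real part
    at a small r > 0. *)
Lemma Re_ge0_right_limit (p : {poly R[i]}) (e : R) : 0 < e ->
  (forall r : R, 0 < r < e -> 0 <= complex.Re p.[r%:C]) -> 0 <= complex.Re p.[0].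
Proof.
move=> e0 hp; rewrite leNgt; apply/negP => p0.
have /factor_theorem[q pE] : root (p - p.[0]%:P) 0.
  by rewrite rootE hornerD hornerN hornerC subrr.
pose b : R[i] := \sum_(i < size q) `|q`_i|.
have qb (r : R) : 0 <= r <= 1 -> complex.Re q.[r%:C] <= complex.Re b.
  move=> /andP[r0 r1].
  have : `|q.[r%:C]| <= b.
    rewrite horner_coef; apply: le_trans (ler_norm_sum _ _ _) _.
    apply: ler_sum => i _; rewrite normrM ler_piMr // normrX.
    by apply: exprn_ile1 => //; rewrite ger0_norm ?ler0c // lecR.
  rewrite lecE => /andP[_]; apply: le_trans.
  rewrite normc_def /=; apply: le_trans (ler_norm _) _.
  by rewrite -sqrtr_sqr ler_wsqrtr // lerDl sqr_ge0.
have b0 : 0 <= complex.Re b.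
  have : 0 <= b by apply: sumr_ge0.
  by rewrite lecE => /andP[_].
pose a := - complex.Re p.[0].
have a0 : 0 < a by rewrite oppr_gt0.
(* The three bounds put r below e, inside [0, 1] where [b] applies, and make (b + 1) r at most a /
   2; the 1 added to b keeps the denominator positive. *)
pose r := Num.min (e / 2) (Num.min 1 (a / (2 * (complex.Re b + 1)))).
have b1 : 0 < complex.Re b + 1 by rewrite ltr_wpDl.
have r0 : 0 < r.
  rewrite !lt_min divr_gt0 //= ltr01 divr_gt0 // mulr_gt0 //.
have re : r < e.
  by apply: le_lt_trans (_ : e / 2 < e); rewrite ?ge_min ?lexx // ltr_pdivrMr // ltr_pMr // ltr1n.
have r1 : r <= 1 by rewrite !ge_min lexx orbT.
have ra : r <= a / (2 * (complex.Re b + 1)) by rewrite !ge_min lexx !orbT.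
have := hp r; rewrite r0 re => /(_ isT).
have -> : p = p.[0]%:P + q * ('X - 0%:P) by rewrite -pE addrC subrK.
rewrite hornerD hornerM hornerC !hornerE subr0 leNgt => /negP; apply.
have -> : complex.Re (p.[0] + q.[r%:C] * r%:C) = - a + complex.Re q.[r%:C] * r.
  by rewrite raddfD /a opprK; case: q.[_] => x y /=; rewrite mulr0 subr0.
rewrite addrC subr_lt0.
apply: le_lt_trans (_ : (complex.Re b + 1) * r < a).
  apply: ler_wpM2r; first exact: ltW.
  by apply: le_trans (qb r _) _; rewrite ?lerDl // (ltW r0) r1.
apply: le_lt_trans (ler_wpM2l (ltW b1) ra) _.
have -> : (complex.Re b + 1) * (a / (2 * (complex.Re b + 1))) = a / 2.
  by field; rewrite gt_eqF.
by lra.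
Qed.

Lemma ReM_conjc (c : R[i]) :
  complex.Re (c * c^*) = complex.Re c ^+ 2 + complex.Im c ^+ 2.
Proof. by case: c => a b /=; rewrite mulrN opprK. Qed.

Lemma ReZ (r : R) (z : R[i]) : complex.Re (r%:C * z) = r * complex.Re z.
Proof. by case: z => a b /=; rewrite mul0r subr0. Qed.

Lemma ReB (x y : R[i]) : complex.Re (x - y) = complex.Re x - complex.Re y.
Proof. by case: x y => ? ? []. Qed.

Lemma horner_conj (p : {poly R[i]}) (z : R[i]) :
  (map_poly Num.conj p).[z^*] = p.[z]^*.
Proof. exact: horner_map. Qed.

(** It is used for f = q times the conjugate of the denominator, whose real part has the sign of
    that of the quotient. The point [s0] is excluded so that a factor |s - s0|^2 can be divided
    out. *)
Definition half_plane_nonneg (f : R[i] -> R[i]) (s0 : R[i]) :=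
  forall s, 0 < complex.Re s -> s != s0 -> 0 <= complex.Re (f s).

(* Along the ray s0 + r w, the factor r^k is positive and can be dropped before
   letting r tend to 0. *)
Lemma ray_limit (q d : {poly R[i]}) (s0 w : R[i]) k :
  0 < complex.Re s0 -> w != 0 ->
  half_plane_nonneg (fun s => q.[s] * (((s - s0) ^+ k) * d.[s])^*) s0 ->
  0 <= complex.Re (q.[s0] * (w ^+ k * d.[s0])^*).
Proof.
move=> s0_gt0 w0 pos.
(* For real r the conjugated factor is itself polynomial in r: its coefficients and the ray are
   conjugated, while r is fixed by conjugation. *)
pose p : {poly R[i]} := (q \Po (s0%:P + w *: 'X)) *
  ((w ^+ k)^* *: (map_poly Num.conj d \Po (s0^*%:P + w^* *: 'X))).
have pE (r : R) : p.[r%:C] =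
    q.[s0 + w * r%:C] * (w ^+ k * d.[s0 + w * r%:C])^*.
  rewrite /p hornerM hornerZ !horner_comp !(hornerD, hornerZ, hornerC, hornerX).
  rewrite rmorphM /= -horner_conj rmorphD rmorphM /=.
  by rewrite [(r%:C)^*](CrealP _) //; apply/complex_realP; exists r.
have := pE 0; rewrite rmorph0 mulr0 addr0 => <-.
(* For 0 < r < e the point s0 + r w stays in the right half-plane, since r |Re w| < Re s0; the 1
   covers Re w = 0. *)
pose e := complex.Re s0 / (`|complex.Re w| + 1).
have w1 : 0 < `|complex.Re w| + 1 by rewrite ltr_wpDl.

apply: (@Re_ge0_right_limit p e); first by rewrite divr_gt0.
move=> r /andP[r0 re]; rewrite pE.
rewrite -(pmulr_rge0 _ (exprn_gt0 k r0)) -ReZ.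
have <- : q.[s0 + w * r%:C] *
    (((s0 + w * r%:C - s0) ^+ k) * d.[s0 + w * r%:C])^* =
    (r ^+ k)%:C * (q.[s0 + w * r%:C] * (w ^+ k * d.[s0 + w * r%:C])^*).
  rewrite addrAC subrr add0r exprMn -rmorphXn /= !rmorphM /=.
  rewrite [((r ^+ k)%:C)^*](CrealP _); last by apply/complex_realP; exists (r ^+ k).
  by ring.
apply: pos; last first.
  by rewrite -subr_eq0 addrAC subrr add0r mulf_neq0 // fmorph_eq0 gt_eqF.
rewrite raddfD /= mulrC ReZ.
have : `|complex.Re w| * r < complex.Re s0.
  apply: le_lt_trans (_ : (`|complex.Re w| + 1) * r < _).
    by apply: ler_wpM2r; rewrite ?lerDl // ltW.
  by rewrite mulrC -ltr_pdivlMr.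
have := ler_norm (- complex.Re w); rewrite normrN => h.
have : - complex.Re w * r <= `|complex.Re w| * r by apply: ler_wpM2r h; rewrite ltW.
by lra.
Qed.

(** Let c = q(s0) conj(d(s0)). If c is nonzero, the direction w = conj(z) with z^(k+1) = - conj(c)
    gives the ray limit -|c|^2 < 0. Such a root can be chosen because the exponent is positive. *)
Lemma vanish_at_pole (q d : {poly R[i]}) (s0 : R[i]) k :
  0 < complex.Re s0 -> d.[s0] != 0 ->
  half_plane_nonneg (fun s => q.[s] * (((s - s0) ^+ k.+1) * d.[s])^*) s0 ->
  q.[s0] = 0.
Proof.
move=> s0_gt0 d0 pos; apply/eqP/negPn/negP => q0.
pose c := q.[s0] * (d.[s0])^*.
have c0 : c != 0 by rewrite mulf_neq0 // fmorph_eq0.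
pose z := k.+1.-root (- c^*).
have zk : z ^+ k.+1 = - c^* by rewrite rootCK.
have w0 : z^* != 0.
  rewrite fmorph_eq0; apply: contra_neq c0 => z0.
  by move: zk; rewrite z0 expr0n /= => /esym/eqP; rewrite oppr_eq0 fmorph_eq0 => /eqP.
have := ray_limit s0_gt0 w0 pos.
have -> : q.[s0] * (z^* ^+ k.+1 * d.[s0])^* = - (c * c^*).
  by rewrite rmorphM rmorphXn /= conjCK zk /c; ring.
rewrite raddfN /= ReM_conjc oppr_ge0 => h.
move: c0; rewrite eq_complex /= -sqrf_eq0 -[complex.Im c == 0]sqrf_eq0.
by rewrite -paddr_eq0 ?sqr_ge0 // eq_le h addr_ge0 ?sqr_ge0.
Qed.

End RightLimit.

Local Notation "x %:F" := (FracField.tofrac x).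

(** * Cancelling poles of polynomial matrices in the right half-plane *)

(** Polarization: the vectors a + b and a + i b give a^H M b + b^H M a = 0 and a^H M b - b^H M a =
    0. Complex vectors are essential, since a real skew-symmetric form vanishes on real vectors. *)
Lemma quadratic_form_eq0 (C : numClosedFieldType) n (M : 'M[C]_n) :
  (forall v : 'cV[C]_n, (v^t* *m M *m v) 0 0 = 0) -> M = 0.
Proof.
move=> h.
have cross (a b : 'cV[C]_n) : (a^t* *m M *m b) 0 0 + (b^t* *m M *m a) 0 0 = 0.
  have := h (a + b).
  rewrite adjmxD !(mulmxDl, mulmxDr) !mx11D !h add0r addr0 => <-.
  by rewrite addrC.
have cross0 (a b : 'cV[C]_n) : (a^t* *m M *m b) 0 0 = 0.
  have := cross a ('i *: b); rewrite adjmxZ conjCi -scalemxAr -!scalemxAl.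
  rewrite !mx11Z mulNr -mulrBr => /eqP; rewrite mulf_eq0 (negPf (neq0Ci _)) /= subr_eq0.
  move=> /eqP e; have := cross a b; rewrite -e -mulr2n => /eqP.
  by rewrite mulrn_eq0 => /eqP.
apply/matrixP => i j; rewrite mxE -(cross0 (delta_mx i 0) (delta_mx j 0)).
rewrite trmx_delta map_delta_mx -rowE -colE !mxE.
by [].
Qed.

Notation eval_mx s := (map_mx (horner_eval s)).

Section PolynomialMatrix.
Variables (R : realType) (m : nat).
Implicit Types (N : 'M[{poly R[i]}]_m) (d : {poly R[i]}) (u : 'cV[R[i]]_m).

(** Only the constant vector is conjugated, so u^H N u remains a polynomial and the scalar pole
    argument applies to it. *)
Definition poly_form N u : {poly R[i]} :=
  (map_mx polyC (u^t*) *m N *m map_mx polyC u) 0 0.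

Lemma horner_poly_form N u s :
  (poly_form N u).[s] = (u^t* *m eval_mx s N *m u) 0 0.
Proof.
have e p q (A : 'M[R[i]]_(p, q)) : map_mx (horner_eval s) (map_mx polyC A) = A.
  by apply/matrixP => i j; rewrite !mxE /horner_eval hornerC.
transitivity (map_mx (horner_eval s)
  (map_mx polyC (u^t*) *m N *m map_mx polyC u) 0 0); first by rewrite mxE.
by rewrite !map_mxM !e.
Qed.

Lemma poly_formZ c N u : poly_form (c *: N) u = c * poly_form N u.
Proof. by rewrite /poly_form -scalemxAr -scalemxAl mxE. Qed.

(** Induction on the order k. For k > 0 every form u^H N u vanishes at s0, hence N(s0) = 0 by
    polarization and X - s0 divides all entries; the quotient satisfies the hypothesis with order k
    - 1. *)
Lemma no_pole_in_half_plane k N d (s0 : R[i]) :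
  0 < complex.Re s0 -> d.[s0] != 0 ->
  (forall u, half_plane_nonneg
     (fun s => (poly_form N u).[s] * ((s - s0) ^+ k * d.[s])^*) s0) ->
  exists2 N1, N = ('X - s0%:P) ^+ k *: N1 &
    forall u, 0 <= complex.Re ((poly_form N1 u).[s0] * (d.[s0])^*).
Proof.
move=> s0_gt0 d0; elim: k N => [|k IH] N pos.
  exists N; first by rewrite expr0 scale1r.
  (* With exponent 0 the ray limit is plain continuity and extends the inequality to the excluded
     point [s0]; any nonzero direction would do. *)
  move=> u; have := @ray_limit _ _ _ s0 1 0 s0_gt0 (oner_neq0 _) (pos u).
  by rewrite expr0 mul1r.
have N0 : eval_mx s0 N = 0.
  apply: quadratic_form_eq0 => v; rewrite -horner_poly_form.
  exact: vanish_at_pole s0_gt0 d0 (pos v).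
have /all_sig2[N' _ NE'] : forall ij, {q : {poly R[i]} | True &
    N ij.1 ij.2 = q * ('X - s0%:P)}.
  move=> [i j] /=; apply: cid2; have /factor_theorem[q qE] : root (N i j) s0.
    by rewrite rootE; move/matrixP: N0 => /(_ i j); rewrite !mxE /horner_eval => ->.
  by exists q.
pose N1 := \matrix_(i, j) N' (i, j).
have NE : N = ('X - s0%:P) *: N1.
  by apply/matrixP => i j; rewrite !mxE (NE' (i, j)) mulrC.
case: (IH N1) => [u s s_gt0 ss0|N2 N2E posN2].
  have := pos u s s_gt0 ss0.
  rewrite NE poly_formZ hornerM hornerXsubC exprS.
  (* One factor s - s0 from the numerator and one conjugated from the denominator combine to |s -
     s0|^2, which is positive away from s0. *)
  have -> : (s - s0) * (poly_form N1 u).[s] * ((s - s0) * (s - s0) ^+ k * d.[s])^* =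
     ((complex.Re (s - s0)) ^+ 2 + (complex.Im (s - s0)) ^+ 2)%:C *
     ((poly_form N1 u).[s] * ((s - s0) ^+ k * d.[s])^*).
    rewrite add_Re2_Im2 normCK !rmorphM /=; ring.
  rewrite ReZ pmulr_rge0 // lt_def paddr_eq0 ?sqr_ge0 // !sqrf_eq0.
  rewrite addr_ge0 ?sqr_ge0 // andbT; apply: contra ss0 => /andP[/eqP a /eqP b].
  by rewrite -subr_eq0 eq_complex a b !eqxx.
exists N2; last by [].
by rewrite NE N2E scalerA exprS.
Qed.

End PolynomialMatrix.

(** * Poles and values of rational functions *)

Section RationalFunction.
Variable F : fieldType.
Implicit Types a b : {poly F}.

Lemma frac_repr (f : {fraction {poly F}}) :
  let r := generic_quotient.repr f in f = (r.1)%:F / (r.2)%:F.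
Proof.
move=> r; have r2 : (r.2)%:F != 0 by rewrite tofrac_eq0 denom_ratioP.
apply: (mulIf r2); rewrite divfK // -[f in LHS]generic_quotient.reprK -/r.
unlock FracField.tofrac; rewrite -[LHS]FracField.pi_mul.
apply/generic_quotient.eqmodP => /=.
by rewrite FracField.equivfE /FracField.mulf !numden_Ratio ?mulf_neq0 ?denom_ratioP ?oner_eq0 // !mulr1 mulrC.
Qed.

(** By Gauss's lemma the denominator in lowest terms divides any other denominator [b], so it does
    not vanish where [b] does not. Poles and values can thus be read off any such fraction. *)
Lemma rational_value f a b s : f = a%:F / b%:F -> b.[s] != 0 ->
  ~~ pole f s /\ rateval s f = a.[s] / b.[s].
Proof.
move=> fE bs; rewrite /pole /rateval /ratnum /ratden.
set r := generic_quotient.repr f; set g := gcdp r.1 r.2.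
have r2 : r.2 != 0 by exact: denom_ratioP.
have b0 : b != 0 by apply: contraNneq bs => ->; rewrite horner0.
have g0 : g != 0 by rewrite gcdp_eq0 negb_and r2 orbT.
have ab : a * r.2 = r.1 * b.
  apply/eqP; rewrite -tofrac_eq !tofracM -eqr_div ?tofrac_eq0 //.
  by rewrite -fE -frac_repr.
have E1 : r.1 = (r.1 %/ g) * g by rewrite divpK // dvdp_gcdl.
have E2 : r.2 = (r.2 %/ g) * g by rewrite divpK // dvdp_gcdr.
set p := r.1 %/ g in E1 *; set q := r.2 %/ g in E2 *.
have pq : a * q = p * b.
  by apply: (mulIf g0); rewrite -mulrA -E2 ab E1 mulrAC.
have cop : coprimep p q by rewrite coprimep_div_gcd // r2 orbT.
have qb : q %| b.
  by rewrite -(Gauss_dvdpr b (_ : coprimep q p)) ?[coprimep q p]coprimep_sym // -pq dvdp_mull.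
have qs : q.[s] != 0.
  by apply: contraNneq bs => q0; have /dvdpP[c ->] := qb; rewrite hornerM q0 mulr0.
split; first by rewrite rootE.
have := congr1 (fun p => p.[s]) pq; rewrite !hornerM => e.
by apply/eqP; rewrite eqr_div // -e.
Qed.

End RationalFunction.

(** * The transfer function *)

Section TransferFunction.
Variables (R : realType) (n m : nat).
Implicit Types (E A : 'M[R[i]]_n) (B : 'M[R[i]]_(n, m)) (C : 'M[R[i]]_(m, n)).
Implicit Types (D : 'M[R[i]]_m).

Definition pencil E A : 'M[{poly R[i]}]_n :=
  'X *: map_mx polyC E - map_mx polyC A.

(** By the adjugate formula for the inverse, this is det(sE - A) times the transfer function of a
    regular pencil. *)
Definition transfer_num E A B C D : 'M[{poly R[i]}]_m :=
  map_mx polyC C *m \adj (pencil E A) *m map_mx polyC B +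
  \det (pencil E A) *: map_mx polyC D.

Lemma eval_mx_const p q s (M : 'M[R[i]]_(p, q)) : eval_mx s (map_mx polyC M) = M.
Proof. by apply/matrixP => i j; rewrite !mxE /horner_eval hornerC. Qed.

Lemma eval_pencil E A s : eval_mx s (pencil E A) = s *: E - A.
Proof.
by rewrite map_mxB map_mxZ !eval_mx_const /= /horner_eval hornerX.
Qed.

Lemma horner_det_pencil E A s : (\det (pencil E A)).[s] = \det (s *: E - A).
Proof. by rewrite -eval_pencil -[LHS]/(horner_eval s _) -det_map_mx. Qed.

Lemma eval_transfer_num E A B C D s :
  eval_mx s (transfer_num E A B C D) =
  C *m \adj (s *: E - A) *m B + \det (s *: E - A) *: D.
Proof.
rewrite map_mxD !map_mxM map_mxZ map_mx_adj !eval_mx_const /= /horner_eval.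
by rewrite horner_det_pencil eval_pencil.
Qed.

Lemma det_pencil_neq0 E A : regular_pencil E A -> \det (pencil E A) != 0.
Proof.
case=> s; rewrite unitmxE unitfE -horner_det_pencil; apply: contraNneq => ->.
by rewrite horner0.
Qed.

Lemma transfer_functionE E A B C D : regular_pencil E A ->
  forall i j, transfer_function (DescriptorSystem E A B C D) i j =
  (transfer_num E A B C D i j)%:F / (\det (pencil E A))%:F.
Proof.
move=> reg i j; have d0 := det_pencil_neq0 reg.
have ratE p q (M : 'M[R[i]]_(p, q)) :
    ratmx M = map_mx (@FracField.tofrac _) (map_mx polyC M).
  by rewrite -map_mx_comp.
rewrite /transfer_function !ratE.
have -> : 'X%:F *: map_mx (@FracField.tofrac _) (map_mx polyC E) -
    map_mx (@FracField.tofrac _) (map_mx polyC A) =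
    map_mx (@FracField.tofrac _) (pencil E A) by rewrite map_mxB map_mxZ.
rewrite /invmx unitmxE unitfE det_map_mx tofrac_eq0 d0 -map_mx_adj.
rewrite -scalemxAr -scalemxAl -!map_mxM.
rewrite /transfer_num; set N := _ *m _ *m _; set d := \det _.
have -> : (N + d *: map_mx polyC D) i j = N i j + d * (map_mx polyC D) i j.
  by rewrite mxE [X in _ + X]mxE.
rewrite tofracD mulrDl tofracM mulrAC divff ?tofrac_eq0 // mul1r.
have add_entry (V : zmodType) (X Y : 'M[V]_m) :
  (X + Y) i j = X i j + Y i j by rewrite mxE.
rewrite add_entry; congr (_ + _); last by rewrite mxE.
have scale_entry (F : fieldType) (c : F) (X : 'M[F]_m) :
  (c *: X) i j = c * X i j by rewrite mxE.
by rewrite scale_entry mulrC; congr (_ / _); rewrite mxE.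
Qed.

Lemma KYP_positive_real K (Sys : descriptor_system R n m) Q :
  regular_pencil (ds_E Sys) (ds_A Sys) -> KYP_solution K Sys Q ->
  positive_real Sys.
Proof.
case: Sys => E A B C D /= reg [_ [_ pM] hE [_ pE]].
pose N := transfer_num E A B C D; pose d := \det (pencil E A).
have d0 : d != 0 by apply: det_pencil_neq0.
have pos u s : 0 < complex.Re s -> 0 <= complex.Re ((poly_form N u).[s] * d.[s]^*).
  move=> s0; rewrite horner_poly_form eval_transfer_num horner_det_pencil.
  (* Scaling the input by det P replaces the inverse of P by its adjugate, so the state equation s E
     x = A x + B v holds even where P is singular. The (KYP) form then gives Re v^H (C x + D v) >=
     Re s times x^H E^H Q x >= 0. *)
  set P := s *: E - A; set x := \adj P *m (B *m u); set v := \det P *: u.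
  have dyn : A *m x + B *m v = s *: (E *m x).
    have -> : B *m v = P *m x by rewrite mulmxA mul_mx_adj mul_scalar_mx -scalemxAr.
    by rewrite mulmxBl -scalemxAl addrC subrK.
  have form := KYP_mx_form A B C D Q x v; rewrite /= /KYP_mx dyn in form.
  have := pM (col_mx x v); rewrite form {form dyn}.
  have -> : (u^t* *m (C *m \adj P *m B + \det P *: D) *m u) 0 0 * (\det P)^* =
      (v^t* *m (C *m x + D *m v)) 0 0.
    rewrite [in RHS]/v adjmxZ -scalemxAl mx11Z mulrC; congr (_ * _ 0 0).
    by rewrite -scalemxAr scalemxAl -mulmxA mulmxDl -!mulmxA.
  have -> : (x^t* *m Q^t* *m (s *: (E *m x))) 0 0 =
      s * (x^t* *m (E^t* *m Q) *m x) 0 0.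
    by rewrite hE -scalemxAr mx11Z !mulmxA.
  have := pE x; move: (_ 0 0) => e e0; move: (_ 0 0) => z.
  rewrite !addcJ -mulrBr pmulr_rge0 // subr_ge0 lecR; apply: le_trans.
  move: e0; case: e => e1 e2; rewrite lecE /= => /andP[/eqP -> e1_ge0].
  by rewrite complexr0 mulrC ReZ mulr_ge0 // ltW.
(* Near s0 the transfer function is rewritten with a denominator not vanishing there: with k the
   multiplicity of s0 in the determinant, the numerator is also divisible by (X - s0)^k. *)
have key s0 : 0 < complex.Re s0 -> exists (N1 : 'M[{poly R[i]}]_m) d1,
    [/\ d1.[s0] != 0, forall i j, transfer_function (DescriptorSystem E A B C D) i j = (N1 i j)%:F / d1%:F &
     forall u, 0 <= complex.Re ((poly_form N1 u).[s0] * (d1.[s0])^*)].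
  move=> s0_gt0; have [k [d1 d10 dE]] := multiplicity_XsubC d s0.
  rewrite d0 /= rootE in d10.
  have [u|N1 NE posN1] := @no_pole_in_half_plane _ _ k N d1 s0 s0_gt0 d10.
    move=> s sgt0 _.
    have -> : (s - s0) ^+ k * d1.[s] = d.[s].
      by rewrite dE hornerM horner_exp hornerXsubC mulrC.
    exact: pos.
  exists N1, d1; split => // i j.
  rewrite transfer_functionE // -/N -/d NE mxE dE [d1 * _]mulrC !tofracM -mulf_div.
  by rewrite divff ?mul1r // tofrac_eq0 expf_neq0 // polyXsubC_eq0.
split=> s0 s0_gt0; have [N1 [d1 [d10 TE posN1]]] := key s0 s0_gt0.
  by move=> i j; have [] := rational_value (TE i j) d10.
set T := map_mx _ _.
have TsE : T = (d1.[s0])^-1 *: eval_mx s0 N1.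
  apply/matrixP => i j; rewrite [LHS]mxE [RHS]mxE [X in _ * X]mxE.
  by have [_ ->] := rational_value (TE i j) d10; rewrite mulrC.
split; first by rewrite adjmxD trmxCK addrC.
move=> v; rewrite mulmxDr mulmxDl mx11D.
have -> : (v^t* *m T^t* *m v) 0 0 = ((v^t* *m T *m v) 0 0)^*.
  by rewrite -mx11_adj !adjmxE mulmxA.
rewrite addcJ mulr_ge0 // ler0c TsE -scalemxAr -scalemxAl mxE -horner_poly_form.
have -> : d1.[s0]^-1 * (poly_form N1 v).[s0] =
    (`|d1.[s0]| ^- 2) * ((poly_form N1 v).[s0] * (d1.[s0])^*).
  rewrite normCK; field; rewrite fmorph_eq0 d10 //.
rewrite -add_Re2_Im2 -fmorphV /= ReZ mulr_ge0 //.
by rewrite invr_ge0 addr_ge0 ?sqr_ge0.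
Qed.

End TransferFunction.

(** * Derivatives on the half-line *)

Section HalflineDerivative.
Variable R : realType.
Implicit Types f g : R -> R.

Local Notation halfline t := (within [set h : R | 0 <= t + h] 0^').

Lemma halfline_cvg_eq (t l : R) (f g : R -> R) : (forall h, h != 0 -> f h = g h) ->
  f h @[h --> halfline t] --> l -> g h @[h --> halfline t] --> l.
Proof.
move=> fg; apply: cvg_trans; apply: near_eq_cvg.
rewrite near_withinE; near=> h => _; apply: fg.
by near: h; exact: nbhs_dnbhs_neq.
Unshelve. all: by end_near. Qed.

Lemma halfline_derivative_cvg f f' (t : R) : derivative_on_halfline f f' -> 0 <= t ->
  f (t + h) @[h --> halfline t] --> f t.
Proof.
move=> df t0; have dft := df t t0.
have h0 : h @[h --> halfline t] --> (0 : R).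
  by move=> A hA; apply: filterS (nbhs_dnbhs hA) => h Ah _; exact: Ah.
have : h * (h^-1 * (f (t + h) - f t)) + f t @[h --> halfline t] --> 0 * f' t + f t.
  by apply: cvgD; [exact: cvgM | exact: cvg_cst].
rewrite mul0r add0r; apply: halfline_cvg_eq => h h0'.
by rewrite mulrA divff // mul1r subrK.
Qed.

Lemma halfline_derivativeD f f' g g' :
  derivative_on_halfline f f' -> derivative_on_halfline g g' ->
  derivative_on_halfline (fun t => f t + g t) (fun t => f' t + g' t).
Proof.
move=> df dg t t0.
have : h^-1 * (f (t + h) - f t) + h^-1 * (g (t + h) - g t) @[h --> halfline t]
    --> f' t + g' t by apply: cvgD; [exact: df | exact: dg].
by apply: halfline_cvg_eq => h _; ring.
Qed.

Lemma halfline_derivativeN f f' : derivative_on_halfline f f' ->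
  derivative_on_halfline (fun t => - f t) (fun t => - f' t).
Proof.
move=> df t t0.
have : - (h^-1 * (f (t + h) - f t)) @[h --> halfline t] --> - f' t.
  by apply: cvgN; exact: df.
by apply: halfline_cvg_eq => h _; ring.
Qed.

Lemma halfline_derivative_cst (c : R) :
  derivative_on_halfline (fun=> c) (fun=> 0).
Proof.
move=> t t0; have : 0 @[h --> halfline t] --> (0 : R) by exact: cvg_cst.
by apply: halfline_cvg_eq => h _; rewrite subrr mulr0.
Qed.

Lemma halfline_derivativeM f f' g g' :
  derivative_on_halfline f f' -> derivative_on_halfline g g' ->
  derivative_on_halfline (fun t => f t * g t) (fun t => f' t * g t + f t * g' t).
Proof.
move=> df dg t t0.
have : h^-1 * (f (t + h) - f t) * g (t + h) + f t * (h^-1 * (g (t + h) - g t))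
    @[h --> halfline t] --> f' t * g t + f t * g' t.
  apply: cvgD; apply: cvgM; first exact: df.
  - exact: halfline_derivative_cvg dg t0.
  - exact: cvg_cst.
  - exact: dg.
by apply: halfline_cvg_eq => h _; ring.
Qed.

(** At t > 0 the constraint 0 <= t + h holds for all small h, so the derivative is two-sided. *)
Lemma halfline_is_derive f f' (t : R) : derivative_on_halfline f f' -> 0 < t ->
  is_derive t 1 f (f' t).
Proof.
move=> df t0.
have tpos : \forall h \near (0 : R)^', 0 <= t + h.
  apply: nbhs_dnbhs; exists t => //= h; rewrite /ball_ /= sub0r normrN => ht.
  by have := ler_norm (- h); rewrite normrN; lra.
have H : h^-1 *: ((f \o shift t) (h *: 1) - f t) @[h --> 0^'] --> f' t.
  move=> A /(df t (ltW t0)) hA.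
  have {}hA : \forall h \near (0 : R)^', 0 <= t + h -> A (h^-1 * (f (t + h) - f t)).
    exact: hA.
  apply: filterS2 tpos hA => h h0 /(_ h0).
  by rewrite /= [h *: 1]mulr1 [h + t]addrC.
apply: DeriveDef; first by apply/cvg_ex; exists (f' t).
by apply: cvg_lim.
Unshelve. all: by end_near. Qed.

Lemma halfline_continuous f f' (t : R) : derivative_on_halfline f f' -> 0 < t ->
  {for t, continuous f}.
Proof.
move=> df t0; have [dft _] := halfline_is_derive df t0.
by apply: differentiable_continuous; exact/derivable1_diffP.
Qed.

Lemma halfline_right_continuous f f' : derivative_on_halfline f f' ->
  f h @[h --> 0^'+] --> f 0.
Proof.
move=> df A /(halfline_derivative_cvg df (lexx 0)) hA.
have {}hA : \forall h \near (0 : R)^', 0 <= 0 + h -> A (f (0 + h)) by exact: hA.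
have {}hA : \forall h \near (0 : R), h != 0 -> 0 <= 0 + h -> A (f (0 + h)).
  exact: hA.
have : \forall h \near (0 : R), 0 < h -> A (f h); last by [].
by apply: filterS hA => h + h0; rewrite add0r; apply; rewrite ?gt_eqF ?ltW.
Qed.

Lemma halfline_within_continuous f f' (T : R) : derivative_on_halfline f f' -> 0 < T ->
  {within `[0, T], continuous f}.
Proof.
move=> df T0; apply/(continuous_within_itvP _ T0); split.
- by move=> t /[!in_itv]/= /andP[t0 _]; exact: halfline_continuous df t0.
- exact: halfline_right_continuous df.
- by apply: cvg_at_left_filter; exact: halfline_continuous df T0.
Qed.

Lemma halfline_integrable f f' (T : R) : derivative_on_halfline f f' -> 0 < T ->
  (@lebesgue_measure R).-integrable `[0, T] (EFin \o f).
Proof.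
move=> df T0; apply: continuous_compact_integrable; first exact: segment_compact.
exact: halfline_within_continuous df T0.
Qed.

(** The derivative [f''] of the integrand provides the continuity of [f'] on [0, T] that the
    fundamental theorem requires. *)
Lemma halfline_FTC f f' f'' (T : R) : derivative_on_halfline f f' ->
  derivative_on_halfline f' f'' -> 0 < T ->
  \int[@lebesgue_measure R]_(t in `[0, T]) f' t = f T - f 0.
Proof.
move=> df df' T0; rewrite /Rintegral (@continuous_FTC2 R f' f) //.
- exact: halfline_within_continuous df' T0.
- split.
  + by move=> t /[!in_itv]/= /andP[t0 _]; have [] := halfline_is_derive df t0.
  + exact: halfline_right_continuous df.
  + by apply: cvg_at_left_filter; exact: halfline_continuous df T0.
- move=> t /[!in_itv]/= /andP[t0 _]; rewrite derive1E.
  by have [_ ->] := halfline_is_derive df t0.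
Qed.

(** Limits are unique because the filter is proper: positive increments are admissible at every t >=
    0, including t = 0. *)
Lemma halfline_derivative_uniq f f1 f2 (t : R) : derivative_on_halfline f f1 ->
  derivative_on_halfline f f2 -> 0 <= t -> f1 t = f2 t.
Proof.
move=> d1 d2 t0; have FF : ProperFilter (halfline t).
  split; last exact: within_filter.
  move=> hA.
  have {}hA : \forall h \near (0 : R), h != 0 -> 0 <= t + h -> False by exact: hA.
  have : \forall h \near (0 : R)^'+, False.
    suff : \forall h \near (0 : R), 0 < h -> False by [].
    by apply: filterS hA => h + h0; apply; rewrite ?gt_eqF ?addr_ge0 // ltW.
  by case/filter_ex.
exact: (cvg_unique _ (d1 t t0) (d2 t t0)).
Qed.

End HalflineDerivative.

(** * Differentiation rules for complex and matrix signals *)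

Section MatrixDerivative.
Variable R : realType.

Definition complex_derivative (f f' : R -> R[i]) :=
  derivative_on_halfline (fun t => complex.Re (f t)) (fun t => complex.Re (f' t)) /\
  derivative_on_halfline (fun t => complex.Im (f t)) (fun t => complex.Im (f' t)).

Lemma eq_complex_derivative f f' g g' : f =1 g -> f' =1 g' ->
  complex_derivative f f' -> complex_derivative g g'.
Proof. by move=> /funext -> /funext ->. Qed.

Lemma complex_derivative_cst c : complex_derivative (fun=> c) (fun=> 0).
Proof. by split; exact: halfline_derivative_cst. Qed.

Lemma complex_derivativeD f f' g g' :
  complex_derivative f f' -> complex_derivative g g' ->
  complex_derivative (fun t => f t + g t) (fun t => f' t + g' t).
Proof.
move=> [rf jf] [rg jg]; split.
- rewrite (_ : (fun t => complex.Re (f t + g t)) =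
      (fun t => complex.Re (f t) + complex.Re (g t))); last first.
    by apply/funext => t; case: (f t) (g t) => ? ? [].
  rewrite (_ : (fun t => complex.Re (f' t + g' t)) =
      (fun t => complex.Re (f' t) + complex.Re (g' t))); last first.
    by apply/funext => t; case: (f' t) (g' t) => ? ? [].
  exact: halfline_derivativeD.
- rewrite (_ : (fun t => complex.Im (f t + g t)) =
      (fun t => complex.Im (f t) + complex.Im (g t))); last first.
    by apply/funext => t; case: (f t) (g t) => ? ? [].
  rewrite (_ : (fun t => complex.Im (f' t + g' t)) =
      (fun t => complex.Im (f' t) + complex.Im (g' t))); last first.
    by apply/funext => t; case: (f' t) (g' t) => ? ? [].
  exact: halfline_derivativeD.
Qed.

Lemma complex_derivativeM f f' g g' :
  complex_derivative f f' -> complex_derivative g g' ->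
  complex_derivative (fun t => f t * g t) (fun t => f' t * g t + f t * g' t).
Proof.
move=> [rf jf] [rg jg]; split.
- rewrite (_ : (fun t => complex.Re (f t * g t)) = (fun t =>
      complex.Re (f t) * complex.Re (g t) + - (complex.Im (f t) * complex.Im (g t)))).
    rewrite (_ : (fun t => complex.Re (f' t * g t + f t * g' t)) = (fun t =>
      (complex.Re (f' t) * complex.Re (g t) + complex.Re (f t) * complex.Re (g' t)) +
      - (complex.Im (f' t) * complex.Im (g t) + complex.Im (f t) * complex.Im (g' t)))).
      by apply: halfline_derivativeD; [|apply: halfline_derivativeN];
        exact: halfline_derivativeM.
    by apply/funext => t; case: (f t) (f' t) (g t) (g' t) => ? ? [? ?] [? ?] [? ?] /=; ring.
  by apply/funext => t; case: (f t) (g t) => ? ? [].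
- rewrite (_ : (fun t => complex.Im (f t * g t)) = (fun t =>
      complex.Re (f t) * complex.Im (g t) + complex.Im (f t) * complex.Re (g t))).
    rewrite (_ : (fun t => complex.Im (f' t * g t + f t * g' t)) = (fun t =>
      (complex.Re (f' t) * complex.Im (g t) + complex.Re (f t) * complex.Im (g' t)) +
      (complex.Im (f' t) * complex.Re (g t) + complex.Im (f t) * complex.Re (g' t)))).
      by apply: halfline_derivativeD; exact: halfline_derivativeM.
    by apply/funext => t; case: (f t) (f' t) (g t) (g' t) => ? ? [? ?] [? ?] [? ?] /=; ring.
  by apply/funext => t; case: (f t) (g t) => ? ? [].
Qed.

Lemma complex_derivative_conj f f' : complex_derivative f f' ->
  complex_derivative (fun t => (f t)^*) (fun t => (f' t)^*).
Proof.
move=> [rf jf]; split.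
  rewrite (_ : (fun t => complex.Re (f t)^*) = (fun t => complex.Re (f t))).
    rewrite (_ : (fun t => complex.Re (f' t)^*) = (fun t => complex.Re (f' t))) //.
    by apply/funext => t; case: (f' t).
  by apply/funext => t; case: (f t).
rewrite (_ : (fun t => complex.Im (f t)^*) = (fun t => - complex.Im (f t))).
  rewrite (_ : (fun t => complex.Im (f' t)^*) = (fun t => - complex.Im (f' t))).
    exact: halfline_derivativeN.
  by apply/funext => t; case: (f' t).
by apply/funext => t; case: (f t).
Qed.

Lemma complex_derivative_sum (I : Type) (r : seq I) (f f' : I -> R -> R[i]) :
  (forall i, complex_derivative (f i) (f' i)) ->
  complex_derivative (fun t => \sum_(i <- r) f i t) (fun t => \sum_(i <- r) f' i t).
Proof.
move=> df; elim: r => [|i r IH].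
  by apply: eq_complex_derivative (complex_derivative_cst 0) => t; rewrite big_nil.
by apply: eq_complex_derivative (complex_derivativeD (df i) IH) => t; rewrite big_cons.
Qed.

Lemma mx_derivative_cst m n (M : 'M[R[i]]_(m, n)) : mx_derivative (fun=> M) (fun=> 0).
Proof.
move=> i j; apply: eq_complex_derivative (complex_derivative_cst (M i j)) => t //.
by rewrite mxE.
Qed.

Lemma mx_derivativeD m n (F F' G G' : R -> 'M[R[i]]_(m, n)) :
  mx_derivative F F' -> mx_derivative G G' ->
  mx_derivative (fun t => F t + G t) (fun t => F' t + G' t).
Proof.
move=> dF dG i j.
by apply: eq_complex_derivative (complex_derivativeD (dF i j) (dG i j)) => t;
  rewrite mxE.
Qed.

Lemma mx_derivativeM m n p (F F' : R -> 'M[R[i]]_(m, n)) (G G' : R -> 'M[R[i]]_(n, p)) :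
  mx_derivative F F' -> mx_derivative G G' ->
  mx_derivative (fun t => F t *m G t) (fun t => F' t *m G t + F t *m G' t).
Proof.
move=> dF dG i j.
have := @complex_derivative_sum _ (index_enum 'I_n) _ _
  (fun k => complex_derivativeM (dF i k) (dG k j)).
apply: eq_complex_derivative => t; first by rewrite mxE.
by rewrite !mxE -big_split.
Qed.

Lemma mx_derivative_mull m n p (M : 'M[R[i]]_(m, n)) (G G' : R -> 'M[R[i]]_(n, p)) :
  mx_derivative G G' -> mx_derivative (fun t => M *m G t) (fun t => M *m G' t).
Proof.
move=> dG; have := mx_derivativeM (mx_derivative_cst M) dG.
by rewrite (_ : (fun t => 0 *m G t + _) = (fun t => M *m G' t)) //;
  apply/funext => t; rewrite mul0mx add0r.
Qed.

Lemma mx_derivative_adj m n (F F' : R -> 'M[R[i]]_(m, n)) :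
  mx_derivative F F' -> mx_derivative (fun t => (F t)^t*) (fun t => (F' t)^t*).
Proof.
move=> dF i j.
by apply: eq_complex_derivative (complex_derivative_conj (dF j i)) => t; rewrite !mxE.
Qed.

Lemma mx_derivative_uniq m n (F F1 F2 : R -> 'M[R[i]]_(m, n)) (t : R) :
  mx_derivative F F1 -> mx_derivative F F2 -> 0 <= t -> F1 t = F2 t.
Proof.
move=> d1 d2 t0; apply/matrixP => i j.
have [r1 i1] := d1 i j; have [r2 i2] := d2 i j.
apply/eqP; rewrite eq_complex (halfline_derivative_uniq r1 r2 t0).
by rewrite (halfline_derivative_uniq i1 i2 t0) !eqxx.
Qed.

End MatrixDerivative.

(** * The dissipation inequality *)

Section IntegralComparison.
Variable R : realType.
Local Notation mu := (@lebesgue_measure R).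

Lemma Rintegral_itv_cst (T c : R) : 0 < T -> \int[mu]_(t in `[0, T]) c = c * T.
Proof.
move=> T0; rewrite Rintegral_cst //= lebesgue_measure_itv /= lte_fin T0.
by rewrite -EFinD /= subr0.
Qed.

Lemma halfline_le_Rintegral (f f' g g' : R -> R) T :
  derivative_on_halfline f f' -> derivative_on_halfline g g' -> 0 < T ->
  (forall t, 0 <= t <= T -> f t <= g t) ->
  \int[mu]_(t in `[0, T]) f t <= \int[mu]_(t in `[0, T]) g t.
Proof.
move=> df dg T0 fg; apply: le_Rintegral => //.
- exact: halfline_integrable df T0.
- exact: halfline_integrable dg T0.
Qed.

(** If g(0) < f(0), the points c1 < c2 at one and two thirds between them separate g from f on some
    [0, T], by right continuity. Integration would give c2 T <= c1 T. *)
Lemma Rintegral_le_at0 (f f' g g' : R -> R) :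
  derivative_on_halfline f f' -> derivative_on_halfline g g' ->
  (forall T, 0 < T ->
    \int[mu]_(t in `[0, T]) f t <= \int[mu]_(t in `[0, T]) g t) ->
  f 0 <= g 0.
Proof.
move=> df dg H; rewrite leNgt; apply/negP => fg.
pose c1 := (2 * g 0 + f 0) / 3; pose c2 := (g 0 + 2 * f 0) / 3.
have c12 : c1 < c2 by rewrite /c1 /c2; lra.
have gc : g 0 < c1 by rewrite /c1; lra.
have fc : c2 < f 0 by rewrite /c2; lra.
have Ng : \forall h \near 0^'+, g h < c1.
  have := halfline_right_continuous dg.
  by move=> /(_ [set z | z < c1]); apply; exact: lt_nbhsl.
have Nf : \forall h \near 0^'+, c2 < f h.
  have := halfline_right_continuous df.
  by move=> /(_ [set z | c2 < z]); apply; exact: lt_nbhsr.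
have [e /= e0 He] := filterI Ng Nf.
pose T := e / 2; have T0 : 0 < T by rewrite divr_gt0.
have near0 t : 0 <= t <= T -> g t <= c1 /\ c2 <= f t.
  (* The right neighbourhood omits 0, so t = 0 is treated apart; T = e / 2 keeps the other points
     strictly within distance e. *)
  rewrite le_eqVlt => /andP[/predU1P[<- _|t0 tT]]; first by rewrite !ltW.
  have [] := He t _ t0; last by move=> /ltW ? /ltW.
  rewrite /ball_ /= sub0r normrN gtr0_norm //; apply: le_lt_trans tT _.
  by rewrite /T; lra.
have d1 := halfline_derivative_cst c1; have d2 := halfline_derivative_cst c2.
have h1 := halfline_le_Rintegral dg d1 T0 (fun t ht => (near0 t ht).1).
have h2 := halfline_le_Rintegral d2 df T0 (fun t ht => (near0 t ht).2).
have := le_trans (le_trans h2 (H T T0)) h1.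
by rewrite !Rintegral_itv_cst // ler_pM2r // leNgt c12.
Qed.

End IntegralComparison.

(** * Stored and supplied energy along a solution *)

Section StorageBalance.
Variables (R : realType) (n m : nat).
Local Notation mu := (@lebesgue_measure R).

Lemma mx_derivative_form (H : 'M[R[i]]_n) (x x1 z z1 : R -> 'cV[R[i]]_n) :
  mx_derivative x x1 -> mx_derivative z z1 ->
  mx_derivative (fun t => (x t)^t* *m H *m z t)
    (fun t => (x1 t)^t* *m H *m z t + (x t)^t* *m H *m z1 t).
Proof.
move=> dx dz; have dHx := mx_derivative_mull H dz.
have := mx_derivativeM (mx_derivative_adj dx) dHx.
rewrite (_ : (fun t => (x t)^t* *m (H *m z t)) = (fun t => (x t)^t* *m H *m z t)).
  rewrite (_ : (fun t => (x1 t)^t* *m (H *m z t) + (x t)^t* *m (H *m z1 t)) =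
    (fun t => (x1 t)^t* *m H *m z t + (x t)^t* *m H *m z1 t)) //.
  by apply/funext => t; rewrite !mulmxA.
by apply/funext => t; rewrite mulmxA.
Qed.

Lemma storage_rateE (H : 'M[R[i]]_n) (x z : 'cV[R[i]]_n) : H^t* = H ->
  complex.Re ((z^t* *m H *m x + x^t* *m H *m z) 0 0) =
  2 * complex.Re ((x^t* *m H *m z) 0 0).
Proof.
move=> hH; have -> : z^t* *m H *m x = (x^t* *m H *m z)^t*.
  by rewrite !adjmxE hH mulmxA.
rewrite mx11D mx11_adj addrC addcJ.
by rewrite (_ : 2 = 2%:C) ?ReZ // rmorph_nat.
Qed.

Lemma storage_balance (H : 'M[R[i]]_n) (x : R -> 'cV[R[i]]_n) d (T : R) :
  H^t* = H -> d 0%N = x -> (forall k, mx_derivative (d k) (d k.+1)) -> 0 < T ->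
  \int[mu]_(t in `[0, T]) (2 * complex.Re (((x t)^t* *m H *m d 1%N t) 0 0)) =
  complex.Re (((x T)^t* *m H *m x T) 0 0) - complex.Re (((x 0)^t* *m H *m x 0) 0 0).
Proof.
move=> hH <- dd T0.
have d1 := mx_derivative_form H (dd 0%N) (dd 0%N).
(* The second derivative of x^H H x, as the fundamental theorem is applied to its first
   derivative. *)
have d2 := mx_derivativeD (mx_derivative_form H (dd 1%N) (dd 0%N))
  (mx_derivative_form H (dd 0%N) (dd 1%N)).
have [r1 _] := d1 0 0; have [r2 _] := d2 0 0.
rewrite -(halfline_FTC r1 r2 T0).
by apply: eq_Rintegral => t _; rewrite storage_rateE.
Qed.

Lemma storage_rate_derivative (H : 'M[R[i]]_n) (x : R -> 'cV[R[i]]_n) d :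
  d 0%N = x -> (forall k, mx_derivative (d k) (d k.+1)) ->
  exists p', derivative_on_halfline
    (fun t => 2 * complex.Re (((x t)^t* *m H *m d 1%N t) 0 0)) p'.
Proof.
move=> <- dd; have [r _] := mx_derivative_form H (dd 0%N) (dd 1%N) 0 0.
have := halfline_derivativeM (halfline_derivative_cst 2) r.
by eexists; eassumption.
Qed.

Lemma supply_derivative (u y : R -> 'cV[R[i]]_m) : smooth u -> smooth y ->
  exists p', derivative_on_halfline
    (fun t => complex.Re (((y t)^t* *m u t) 0 0)) p'.
Proof.
move=> [du [<- dU]] [dy [<- dY]].
have [r _] := mx_derivativeM (mx_derivative_adj (dY 0%N)) (dU 0%N) 0 0.
by eexists; eassumption.
Qed.

(** The system prescribes only the derivative of E x. Since x is itself smooth, uniqueness of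
    derivatives identifies it with E x', also for singular E. *)
Lemma smooth_solution_dynamics K E A B C D x0 (x : R -> 'cV[R[i]]_n)
    (u y : R -> 'cV[R[i]]_m) :
  smooth_solution K (DescriptorSystem E A B C D) x0 x u y ->
  exists2 d, d 0%N = x /\ (forall k, mx_derivative (d k) (d k.+1)) &
    forall t, 0 <= t -> E *m d 1%N t = A *m x t + B *m u t.
Proof.
move=> [_ [[d [d0 dd]] _ _] dyn _ _]; exists d => // t t0.
have dE := mx_derivative_mull E (dd 0%N); rewrite d0 in dE.
exact: (mx_derivative_uniq dE dyn t0).
Qed.

Lemma KYP_storage K (Sys : descriptor_system R n m) Q :
  KYP_solution K Sys Q -> storage_function K Sys (quadratic_storage Sys Q).
Proof.
case: Sys => E A B C D [_ [_ pM] hE [hH pH]] x0 _ x u y sol T T0.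
have [d [d0 dd] dyn] := smooth_solution_dynamics sol.
case: sol => _ [sx su sy] _ x00 out.
pose H : 'M[R[i]]_n := 2^-1 *: (E^t* *m Q).
have H_herm : H^t* = H by rewrite adjmxZ conj_half hH.
have SE z : quadratic_storage (DescriptorSystem E A B C D) Q z =
    (z^t* *m H *m z) 0 0.
  rewrite /quadratic_storage /H -scalemxAr -scalemxAl mx11Z /=.
  by rewrite hE !mulmxA.
have S_ge0 (z : 'cV[R[i]]_n) : 0 <= (z^t* *m H *m z) 0 0.
  rewrite -SE; apply: mulr_ge0; first by rewrite invr_ge0.
  by have := pH z; rewrite hE !mulmxA.
rewrite !SE; split=> //.
have SRe (z : 'cV[R[i]]_n) : (z^t* *m H *m z) 0 0 = (complex.Re ((z^t* *m H *m z) 0 0))%:C.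
  by rewrite RRe_real // ger0_real.
rewrite SRe [X in _ - X]SRe -rmorphB lecR /supplied_energy.
move: T0; rewrite le_eqVlt => /predU1P[<-|T0].
  by rewrite subrr set_itv1 Rintegral_set1.
rewrite -(storage_balance H_herm d0 dd T0).
have [p' dp] := storage_rate_derivative H d0 dd.
have [s' ds] := supply_derivative su sy.
apply: halfline_le_Rintegral dp ds T0 _ => t /andP[t0 _].
(* Semidefiniteness at (x(t), u(t)) is the pointwise inequality between storage rate and supplied
   power, because Q^H E x' = 2 H x'. *)
have := pM (col_mx (x t) (u t)).
have form := KYP_mx_form A B C D Q (x t) (u t); rewrite /= /KYP_mx in form.
rewrite form {form} -(out _ t0) -(dyn _ t0).
have -> : (x t)^t* *m Q^t* *m (E *m d 1%N t) =
    2 *: ((x t)^t* *m H *m d 1%N t).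
  by rewrite /H -scalemxAr -scalemxAl double_mx half_double hE !mulmxA.
have -> : ((y t)^t* *m u t) 0 0 = (((u t)^t* *m y t) 0 0)^*.
  by rewrite -mx11_adj !adjmxE.
rewrite mx11Z; move: (_ 0 0) (_ 0 0) => w z.
rewrite !addcJ -mulrBr pmulr_rge0 // subr_ge0 lecR.
have -> : (2 : R[i]) = 2%:C by rewrite rmorph_nat.
by rewrite ReZ; case: z.
Qed.

End StorageBalance.

(** * Linear differential equations with constant coefficients *)

Section ExponentialSeries.
Variable R : realType.
Implicit Types a b : R ^nat.

(** Geometric growth makes the sum of a_k t^k / k! converge for every t, by comparison with M exp(c
    |t|), and it survives the index shift that differentiation causes. *)
Definition exp_bounded a := exists M c, [/\ 0 <= M, 0 <= c & forall k, `|a k| <= M * c ^+ k].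

Definition exp_series a (t : R) := limn (pseries (fun k => a k / k`!%:R) t).

Lemma exp_series_cvg a t : exp_bounded a -> cvgn (pseries (fun k => a k / k`!%:R) t).
Proof.
move=> [M [c [M0 c0 ac]]]; apply: normed_cvg.
apply: (@series_le_cvg _ _ (fun k => M * exp_coeff (c * `|t|) k)).
- by move=> k; exact: normr_ge0.
- by move=> k; rewrite mulr_ge0 // exp_coeff_ge0 // mulr_ge0.
- move=> k; rewrite /exp_coeff /= !normrM normrX normfV normr_nat exprMn.
  rewrite mulrAC !mulrA ler_pM2r ?invr_gt0 ?ltr0n ?fact_gt0 //.
  by rewrite ler_wpM2r // exprn_ge0.
- have := @is_cvg_seriesZ R _ M (is_cvg_series_exp_coeff (c * `|t|)).
  by rewrite (_ : M *: _ = (fun k => M * exp_coeff (c * `|t|) k)).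
Qed.

Lemma exp_boundedD a b : exp_bounded a -> exp_bounded b ->
  exp_bounded (fun k => a k + b k).
Proof.
move=> [M [c [M0 c0 ac]]] [N [d [N0 d0 bd]]]; exists (M + N), (Num.max c d).
split=> [||k]; rewrite ?addr_ge0 ?le_max ?c0 //.
apply: le_trans (ler_normD _ _) _; rewrite mulrDl lerD //.
  apply: le_trans (ac k) _; rewrite ler_wpM2l // lerXn2r ?nnegrE ?le_max ?c0 ?lexx //.
apply: le_trans (bd k) _; rewrite ler_wpM2l // lerXn2r ?nnegrE ?le_max ?d0 ?lexx ?orbT //.
Qed.

Lemma exp_boundedZ z a : exp_bounded a -> exp_bounded (fun k => z * a k).
Proof.
move=> [M [c [M0 c0 ac]]]; exists (`|z| * M), c; split=> [||k] //.
  by rewrite mulr_ge0.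
by rewrite normrM -mulrA ler_wpM2l.
Qed.

Lemma exp_bounded_shift a : exp_bounded a -> exp_bounded (fun k => a k.+1).
Proof.
move=> [M [c [M0 c0 ac]]]; exists (M * c), c; split=> [||k] //.
  by rewrite mulr_ge0.
by rewrite -mulrA -exprS.
Qed.

Lemma exp_seriesD a b t : exp_bounded a -> exp_bounded b ->
  exp_series (fun k => a k + b k) t = exp_series a t + exp_series b t.
Proof.
move=> ha hb; rewrite /exp_series -limD; try exact: exp_series_cvg.
congr (limn _); apply/funext => k.
transitivity (pseries (fun k => a k / k`!%:R) t k + pseries (fun k => b k / k`!%:R) t k) => //.
rewrite /pseries /series /= -big_split.
by apply: eq_bigr => i _ /=; rewrite !mulrDl.
Qed.

Lemma exp_seriesZ z a t : exp_bounded a ->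
  exp_series (fun k => z * a k) t = z * exp_series a t.
Proof.
move=> ha; apply: cvg_lim => //.
have : z * pseries (fun k => a k / k`!%:R) t k @[k --> \oo] --> z * exp_series a t.
  by apply: cvgMr; exact: exp_series_cvg.
apply: cvg_trans; apply: near_eq_cvg; near=> k.
by rewrite /pseries /series /= big_distrr; apply: eq_bigr => i _ /=; rewrite !mulrA.
Unshelve. all: by end_near. Qed.

Lemma exp_series0 t : exp_series (fun=> 0) t = 0.
Proof.
apply: cvg_lim => //; rewrite (_ : pseries _ _ = fun=> 0); first exact: cvg_cst.
by apply/funext => k; rewrite /pseries /series /= big1 // => i _; rewrite !mul0r.
Qed.

Lemma exp_series_at0 a : exp_series a 0 = a 0%N.
Proof.
apply: cvg_lim => //; apply/cvg_ballP => e e0; exists 1%N => // k /= k1.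
rewrite /pseries /series /= -(prednK k1) big_nat_recl // big1 ?addr0.
  by rewrite expr0 mulr1 divr1; exact: ballxx.
by move=> i _; rewrite expr0n mulr0.
Qed.

Lemma exp_series_is_derive a (t : R) : exp_bounded a ->
  is_derive t 1 (exp_series a) (exp_series (fun k => a k.+1) t).
Proof.
move=> ha; have ha1 := exp_bounded_shift ha; have ha2 := exp_bounded_shift ha1.
have diffsE b : pseries_diffs (fun k => b k / k`!%:R) = (fun k => b k.+1 / k`!%:R).
  by apply/funext => k; rewrite /pseries_diffs factS natrM invfM mulrCA mulVKf.
rewrite /exp_series -diffsE.
(* Termwise differentiation at t needs convergence of the series and of its first two derived series
   at a point beyond |t|; |t| + 1 serves. *)
apply: (@pseries_snd_diffs _ _ (`|t| + 1)); rewrite ?diffsE.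
- exact: exp_series_cvg.
- exact: exp_series_cvg.
- exact: exp_series_cvg.
- by rewrite [ltRHS]ger0_norm ?addr_ge0 // ltrDl.
Qed.

Lemma is_derive_halfline (f f' : R -> R) :
  (forall t : R, is_derive t 1 f (f' t)) -> derivative_on_halfline f f'.
Proof.
move=> df t t0; have [+ fE] := df t; move=> /cvg_ex[l fl].
have lE : l = f' t by rewrite -fE; apply/esym/cvg_lim.
apply: cvg_within_filter; rewrite -lE; apply: cvg_trans fl.
apply: near_eq_cvg; near=> h => /=.
by rewrite [h *: 1]mulr1 [h + t]addrC.
Unshelve. all: by end_near. Qed.

End ExponentialSeries.

(** * The flow of a linear differential equation *)

Section LinearODE.
Variable R : realType.

Definition cexp_bounded (a : nat -> R[i]) :=
  exp_bounded (fun k => complex.Re (a k)) /\ exp_bounded (fun k => complex.Im (a k)).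

Definition cexp_series (a : nat -> R[i]) (t : R) : R[i] :=
  exp_series (fun k => complex.Re (a k)) t +i* exp_series (fun k => complex.Im (a k)) t.

Lemma cexp_bounded_norm a (M c : R[i]) : 0 <= M -> 0 <= c ->
  (forall k, `|a k| <= M * c ^+ k) -> cexp_bounded a.
Proof.
move=> M0 c0 ac.
have [m mE] : exists m, M = m%:C by apply/complex_realP/ger0_real.
have [d dE] : exists d, c = d%:C by apply/complex_realP/ger0_real.
have m0 : 0 <= m by rewrite -ler0c -mE.
have d0 : 0 <= d by rewrite -ler0c -dE.
have nb k : Num.sqrt (complex.Re (a k) ^+ 2 + complex.Im (a k) ^+ 2) <= m * d ^+ k.
  by have := ac k; rewrite normc_def mE dE -rmorphXn -rmorphM lecR.
split; exists m, d; split=> // k; apply: le_trans (nb k);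
  by rewrite -sqrtr_sqr ler_wsqrtr // ?lerDl ?lerDr sqr_ge0.
Qed.

Lemma cexp_seriesD a b t : cexp_bounded a -> cexp_bounded b ->
  cexp_series (fun k => a k + b k) t = cexp_series a t + cexp_series b t.
Proof.
move=> [ra ia] [rb ib]; rewrite /cexp_series.
apply/eqP; rewrite eq_complex /= -!exp_seriesD //.
by apply/andP; split; apply/eqP; congr (exp_series _ t); apply/funext => k;
  case: (a k) (b k) => ? ? [].
Qed.

Lemma cexp_boundedD a b : cexp_bounded a -> cexp_bounded b ->
  cexp_bounded (fun k => a k + b k).
Proof.
move=> [ra ia] [rb ib]; split.
- rewrite (_ : (fun k => _) = (fun k => complex.Re (a k) + complex.Re (b k))).
    exact: exp_boundedD.
  by apply/funext => k; case: (a k) (b k) => ? ? [].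
- rewrite (_ : (fun k => _) = (fun k => complex.Im (a k) + complex.Im (b k))).
    exact: exp_boundedD.
  by apply/funext => k; case: (a k) (b k) => ? ? [].
Qed.

Lemma cexp_boundedZ z a : cexp_bounded a -> cexp_bounded (fun k => z * a k).
Proof.
move=> [ra ia]; split.
- rewrite (_ : (fun k => _) = (fun k => complex.Re z * complex.Re (a k) +
      (- complex.Im z) * complex.Im (a k))).
    by apply: exp_boundedD; exact: exp_boundedZ.
  by apply/funext => k; rewrite mulNr; case: (a k) z => ? ? [].
- rewrite (_ : (fun k => _) = (fun k => complex.Re z * complex.Im (a k) +
      complex.Im z * complex.Re (a k))).
    by apply: exp_boundedD; exact: exp_boundedZ.
  by apply/funext => k; case: (a k) z => ? ? [].
Qed.

Lemma cexp_seriesZ z a t : cexp_bounded a ->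
  cexp_series (fun k => z * a k) t = z * cexp_series a t.
Proof.
move=> [ra ia]; rewrite /cexp_series; case: z => x y.
apply/eqP; rewrite eq_complex /= -mulNr -!exp_seriesZ //.
rewrite -!exp_seriesD //; try exact: exp_boundedZ.
by apply/andP; split; apply/eqP; congr (exp_series _ t); apply/funext => k;
  case: (a k) => ? ? /=; rewrite ?mulNr.
Qed.

Lemma cexp_series_sum (I : Type) (r : seq I) (a : I -> nat -> R[i]) t :
  (forall i, cexp_bounded (a i)) ->
  cexp_bounded (fun k => \sum_(i <- r) a i k) /\
  cexp_series (fun k => \sum_(i <- r) a i k) t = \sum_(i <- r) cexp_series (a i) t.
Proof.
move=> ha; elim: r => [|i r [IHb IH]].
  rewrite big_nil (_ : (fun k => _) = fun=> 0); last first.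
    by apply/funext => k; rewrite big_nil.
  split; last by rewrite /cexp_series /= !exp_series0.
  by split; exists 0, 0; split=> // k; rewrite normr0 mul0r.
rewrite big_cons (_ : (fun k => _) = fun k => a i k + \sum_(j <- r) a j k).
  by split; [exact: cexp_boundedD | rewrite cexp_seriesD // IH].
by apply/funext => k; rewrite big_cons.
Qed.

Variables (n : nat) (M : 'M[R[i]]_n).

(** This is exp(tM) v, written entrywise as the sum of (M^k v)_i t^k / k!. *)
Definition flow (v : 'cV[R[i]]_n) (t : R) : 'cV[R[i]]_n :=
  \col_i cexp_series (fun k => iter k (mulmx M) v i 0) t.

(** The sum [c] of the moduli of all entries of M dominates every row sum, so each application of M
    multiplies the bound on the entries by at most c. *)
Lemma iter_mulmx_bounded (v : 'cV[R[i]]_n) i :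
  cexp_bounded (fun k => iter k (mulmx M) v i 0).
Proof.
pose c : R[i] := \sum_i \sum_j `|M i j|; pose b : R[i] := \sum_i `|v i 0|.
have c0 : 0 <= c by apply: sumr_ge0 => *; apply: sumr_ge0.
have b0 : 0 <= b by apply: sumr_ge0.
apply: (@cexp_bounded_norm _ b c) => // k; elim: k i => [|k IH] i.
  by rewrite expr0 mulr1 /b (bigD1 i) //= lerDl sumr_ge0.
rewrite iterS mxE; apply: le_trans (ler_norm_sum _ _ _) _.
apply: (@le_trans _ _ (\sum_j `|M i j| * (b * c ^+ k))).
  by apply: ler_sum => j _; rewrite normrM ler_wpM2l.
rewrite -mulr_suml exprS [leRHS]mulrCA ler_wpM2r ?mulr_ge0 ?exprn_ge0 //.
by rewrite /c [leRHS](bigD1 i) //= lerDl sumr_ge0 // => *; apply: sumr_ge0.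
Qed.

Lemma flow0 v : flow v 0 = v.
Proof.
apply/matrixP => i j; rewrite !mxE ord1 /cexp_series !exp_series_at0 /=.
by case: (v i 0).
Qed.

Lemma flow_mulmx v t : flow (M *m v) t = M *m flow v t.
Proof.
apply/matrixP => i j; rewrite !mxE.
transitivity (\sum_k cexp_series (fun l => M i k * iter l (mulmx M) v k 0) t); last first.
  apply: eq_bigr => k _; rewrite [flow _ _ _ _]mxE cexp_seriesZ //.
  exact: iter_mulmx_bounded.
have [|_ <-] := @cexp_series_sum _ (index_enum 'I_n)
  (fun j k => M i j * iter k (mulmx M) v j 0) t.
  by move=> k; apply: cexp_boundedZ; exact: iter_mulmx_bounded.
congr (cexp_series _ t); apply/funext => k.
by rewrite -iterSr iterS mxE.
Qed.

Lemma flow_derivative v : mx_derivative (flow v) (fun t => M *m flow v t).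
Proof.
move=> i j; have [rb ib] := iter_mulmx_bounded v i.
have E t : (M *m flow v t) i j = cexp_series (fun k => iter k.+1 (mulmx M) v i 0) t.
  rewrite -flow_mulmx mxE; congr (cexp_series _ t); apply/funext => k.
  by rewrite iterSr.
apply: (@eq_complex_derivative _ (cexp_series (fun k => iter k (mulmx M) v i 0))
   (cexp_series (fun k => iter k.+1 (mulmx M) v i 0))).
- by move=> t; rewrite mxE.
- by move=> t; rewrite E.
- by split; apply: is_derive_halfline => t; exact: exp_series_is_derive.
Qed.

Lemma flow_iter_derivative v k :
  mx_derivative (fun t => iter k (mulmx M) (flow v t))
                (fun t => iter k.+1 (mulmx M) (flow v t)).
Proof.
elim: k => [|k IH]; first exact: flow_derivative.
exact: mx_derivative_mull.
Qed.

Lemma flow_over K v t : mx_over K M -> mx_over K v -> mx_over K (flow v t).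
Proof.
move=> oM ov; have ok k : mx_over K (iter k (mulmx M) v).
  by elim: k => // k IH; rewrite iterS; exact: mx_overM.
move=> i j; rewrite mxE; case: K ok {oM ov} => // ok.
rewrite /= inE complex_real (_ : (fun k => _) = fun=> 0) ?exp_series0 //.
by apply/funext => k; have := ok k i 0; rewrite /= inE => /complex_realP[z ->].
Qed.

End LinearODE.

(** * From passivity to (KYP) *)

Lemma hermitian_half (C : numClosedFieldType) n (H : 'M[C]_n) :
  H^t* = H -> (2^-1 *: H)^t* = 2^-1 *: H.
Proof. by move=> hH; rewrite adjmxZ conj_half hH. Qed.

Lemma hermitian_adjD (C : numClosedFieldType) n (Q E : 'M[C]_n) :
  (Q^t* *m E + E^t* *m Q)^t* = Q^t* *m E + E^t* *m Q.
Proof. by rewrite !adjmxE addrC. Qed.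

Lemma hermitian_factor (C : numClosedFieldType) n (E H : 'M[C]_n) :
  E \in unitmx -> H^t* = H ->
  E^t* *m (invmx (E^t*) *m H) = H /\ (invmx (E^t*) *m H)^t* *m E = H.
Proof.
by move=> uE hH; rewrite mulKVmx ?adjmx_unit // adjmxM adjmx_inv trmxCK hH mulmxKV.
Qed.

(** A real value equals the average of itself and its conjugate, which is the form of the Hermitian
    part of Q^H E. *)
Lemma form_half_sum (C : numClosedFieldType) n (Q E : 'M[C]_n) (z : 'cV[C]_n) :
  ((z^t* *m Q^t* *m E *m z) 0 0)^* = (z^t* *m Q^t* *m E *m z) 0 0 ->
  (z^t* *m (2^-1 *: (Q^t* *m E + E^t* *m Q)) *m z) 0 0 =
  (z^t* *m Q^t* *m E *m z) 0 0.
Proof.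
move=> e_real; rewrite -scalemxAr -scalemxAl mulmxDr mulmxDl mx11Z mx11D.
have -> : z^t* *m (E^t* *m Q) *m z = (z^t* *m Q^t* *m E *m z)^t*.
  by rewrite !adjmxE !mulmxA.
by rewrite mx11_adj e_real !mulmxA [RHS]splitr mulrDr [_ * 2^-1]mulrC.
Qed.

Lemma KYP_mx_hermitian (C : numClosedFieldType) n m (A Q : 'M[C]_n)
    (B : 'M[C]_(n, m)) (Co : 'M[C]_(m, n)) (D : 'M[C]_m) :
  (KYP_mx A B Co D Q)^t* = KYP_mx A B Co D Q.
Proof. by rewrite /KYP_mx !adjmxE; congr block_mx; rewrite addrC. Qed.

Section PassiveKYP.
Variables (R : realType) (K : scalar_field) (n m : nat).

Lemma mx_derivative_usub p q r (F F' : R -> 'M[R[i]]_(p + q, r)) :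
  mx_derivative F F' ->
  mx_derivative (fun t => usubmx (F t)) (fun t => usubmx (F' t)).
Proof.
move=> dF i j; apply: eq_complex_derivative (dF (lshift q i) j) => t;
  by rewrite mxE.
Qed.

Lemma mx_derivative_dsub p q r (F F' : R -> 'M[R[i]]_(p + q, r)) :
  mx_derivative F F' ->
  mx_derivative (fun t => dsubmx (F t)) (fun t => dsubmx (F' t)).
Proof.
move=> dF i j; apply: eq_complex_derivative (dF (rshift p i) j) => t;
  by rewrite mxE.
Qed.

(* The input is adjoined to the state with zero derivative, which makes every
   pair of initial state and initial input the start of a smooth solution. *)
Lemma smooth_solution_exists E A B C D (x0 : 'cV[R[i]]_n) (u0 : 'cV[R[i]]_m) :
  system_over K (DescriptorSystem E A B C D) -> E \in unitmx ->
  mx_over K x0 -> mx_over K u0 ->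
  exists x u y, smooth_solution K (DescriptorSystem E A B C D) x0 x u y /\ u 0 = u0.
Proof.
move=> [oE oA oB oC oD] uE ox ou.
pose M : 'M[R[i]]_(n + m) := block_mx (invmx E *m A) (invmx E *m B) 0 0.
have oM : mx_over K M.
  by apply: mx_over_block; try exact: mx_over0; apply: mx_overM => //;
    exact: mx_over_inv.
pose d k t := iter k (mulmx M) (flow M (col_mx x0 u0) t).
have dd k : mx_derivative (d k) (d k.+1) := flow_iter_derivative M (col_mx x0 u0) k.
have d0 : d 0%N 0 = col_mx x0 u0 by rewrite /d /= flow0.
have od t : mx_over K (d 0%N t) by apply: flow_over => //; exact: mx_over_col.
exists (fun t => usubmx (d 0%N t)), (fun t => dsubmx (d 0%N t)),
  (fun t => C *m usubmx (d 0%N t) + D *m dsubmx (d 0%N t)).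
split; last by rewrite d0 col_mxKd.
split.
- move=> t _; have ox1 := mx_over_usub (od t); have ou1 := mx_over_dsub (od t).
  by split=> //; apply: mx_overD; apply: mx_overM.
- split.
  + exists (fun k t => usubmx (d k t)); split=> // k.
    exact: mx_derivative_usub (dd k).
  + exists (fun k t => dsubmx (d k t)); split=> // k.
    exact: mx_derivative_dsub (dd k).
  + exists (fun k t => C *m usubmx (d k t) + D *m dsubmx (d k t)); split=> // k.
    by apply: mx_derivativeD; apply: mx_derivative_mull;
      [exact: mx_derivative_usub (dd k) | exact: mx_derivative_dsub (dd k)].
- have := mx_derivative_mull E (mx_derivative_usub (dd 0%N)).
  rewrite (_ : (fun t => E *m usubmx (d 1%N t)) =
    (fun t => A *m usubmx (d 0%N t) + B *m dsubmx (d 0%N t))) //.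
  apply/funext => t; rewrite /d /= -[flow M _ t]vsubmxK mul_block_col.
  by rewrite !col_mxKu col_mxKd mulmxDr !mulmxA mulmxV // !mul1mx.
- by rewrite d0 col_mxKu.
- by [].
Qed.

(* Over the reals a storage function determines only the symmetric part of
   Q^T E, so the solution of (KYP) is built from that part. *)
Lemma passive_KYP (Sys : descriptor_system R n m) :
  system_over K Sys -> passive K Sys -> ds_E Sys \in unitmx -> KYP K Sys.
Proof.
case: Sys => E A B C D oSys [Q [oQ st]] /= uE; have [oE oA oB oC oD] := oSys.
pose H : 'M[R[i]]_n := 2^-1 *: (Q^t* *m E + E^t* *m Q).
have oH : mx_over K H.
  apply: mx_over_half; apply: mx_overD; apply: mx_overM => //;
    exact: mx_over_adj.
have hH : H^t* = H := hermitian_half (hermitian_adjD Q E).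
(* In the order of [R[i]] nonnegativity includes being real, which is what allows Q^H E to be
   replaced by its Hermitian part. *)
have SE (z : 'cV[R[i]]_n) : 0 <= quadratic_storage (DescriptorSystem E A B C D) Q z ->
    quadratic_storage (DescriptorSystem E A B C D) Q z =
    (z^t* *m (2^-1 *: H) *m z) 0 0.
  rewrite /quadratic_storage -scalemxAr -scalemxAl mx11Z => S0.
  have half_gt0 : (0 : R[i]) < 2^-1 by rewrite invr_gt0.
  rewrite form_half_sum //; apply/CrealP/ger0_real.
  by rewrite -(pmulr_rge0 _ half_gt0).
clearbody H.
(* Invertibility of E lets the Hermitian matrix H be factored as E^H Q'; this Q' is the candidate
   for (KYP). *)
have [Q' [oQ' EQ QE]] : exists Q', [/\ mx_over K Q', E^t* *m Q' = H &
    Q'^t* *m E = H].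
  exists (invmx (E^t*) *m H); have [-> ->] := hermitian_factor uE hH.
  by split=> //; apply: mx_overM => //; apply: mx_over_inv; exact: mx_over_adj.
have [G hG GE] : exists2 G : 'M[R[i]]_n, G^t* = G & H = 2 *: G.
  exists (2^-1 *: H); first exact: hermitian_half.
  by rewrite double_mx half_double.
have {}SE (z : 'cV[R[i]]_n) :
    0 <= quadratic_storage (DescriptorSystem E A B C D) Q z ->
    quadratic_storage (DescriptorSystem E A B C D) Q z = (z^t* *m G *m z) 0 0.
  move=> /SE ->; rewrite GE; congr ((_ *m _ *m _) 0 0).
  by rewrite double_mx scalerDr half_double.
have key (x0 : 'cV[R[i]]_n) (u0 : 'cV[R[i]]_m) : mx_over K x0 -> mx_over K u0 ->
    0 <= (x0^t* *m G *m x0) 0 0 /\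
    complex.Re ((x0^t* *m Q'^t* *m (A *m x0 + B *m u0)) 0 0) <=
    complex.Re ((u0^t* *m (C *m x0 + D *m u0)) 0 0).
  move=> ox ou.
  have [x [u [y [sol u0E]]]] := smooth_solution_exists oSys uE ox ou.
  have cons : consistent K (DescriptorSystem E A B C D) x0 by exists x, u, y.
  have {}st := st _ cons _ _ _ sol.
  have [d [d0 dd] dyn] := smooth_solution_dynamics sol.
  case: sol => _ [_ su sy] _ x0E out.
  (* Taking T = 0 in the storage property gives nonnegativity at the initial state. *)
  split; first by have [_ S0] := st 0 (lexx 0); rewrite -x0E -SE.
  have [p' dp] := storage_rate_derivative G d0 dd.
  have [s' ds] := supply_derivative su sy.
  have := Rintegral_le_at0 dp ds _.
  rewrite out // u0E x0E.
  have -> : (C *m x0 + D *m u0)^t* *m u0 = (u0^t* *m (C *m x0 + D *m u0))^t*.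
    by rewrite adjmxM trmxCK.
  have -> : x0^t* *m Q'^t* *m (A *m x0 + B *m u0) = 2 *: (x0^t* *m G *m d 1%N 0).
    rewrite -x0E -u0E -dyn // scalemxAl scalemxAr -GE -QE.
    by rewrite !mulmxA.
  rewrite mx11Z mx11_adj.
  have -> : (2 : R[i]) = 2%:C by rewrite rmorph_nat.
  rewrite ReZ => H1; apply: le_trans (H1 _) _; last first.
    by move: (_ 0 0) => z; case: z.
  move=> T T0; rewrite (storage_balance hG d0 dd T0).
  have [+ ST] := st T (ltW T0); have [_ S0] := st 0 (lexx 0).
  by rewrite (SE _ ST) (SE _ S0) lecE ReB => /andP[].
exists Q'; split; [exact: oQ'| |by rewrite EQ QE|].
(* Passivity constrains only solutions over K, so the form is tested on vectors over K; each one
   splits into an initial state and an initial input. *)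
- apply: (@psdmx_over _ K).
  + apply: mx_over_block.
    * by apply: mx_overD; apply: mx_overN; apply: mx_overM => //; exact: mx_over_adj.
    * apply: mx_overD; [|apply: mx_overN; apply: mx_overM => //]; exact: mx_over_adj.
    * apply: mx_overD => //; apply: mx_overN; apply: mx_overM => //; exact: mx_over_adj.
    * by apply: mx_overD => //; exact: mx_over_adj.
  + exact: KYP_mx_hermitian.
  + move=> v ov; rewrite -[v]vsubmxK.
    have [_] := key _ _ (mx_over_usub ov) (mx_over_dsub ov).
    have := KYP_mx_form A B C D Q' (usubmx v) (dsubmx v).
    rewrite /= /KYP_mx => ->; move: (_ 0 0) (_ 0 0) => w z wz.
    by rewrite !addcJ -mulrBr mulr_ge0 // subr_ge0 lecR.
- rewrite EQ; apply: (psdmx_over oH hH) => x ox.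
  have [Gx _] := key x 0 ox (@mx_over0 _ _ _ _).
  by rewrite GE -scalemxAr -scalemxAl mx11Z mulr_ge0.
Qed.

End PassiveKYP.

(** * Implications between (pH), (KYP), (PR) and (Pa) *)

Theorem proposition2p1 (R : realType) (K : scalar_field) (n m : nat)
    (Sys : descriptor_system R n m)
    (hK : system_over K Sys)
    (hreg : regular_pencil (ds_E Sys) (ds_A Sys)) :
  [/\ (pH K Sys -> KYP K Sys) /\
      (KYP K Sys -> positive_real Sys /\ passive K Sys),
      (forall Q, pH_with K Sys Q -> KYP_solution K Sys Q) /\
      (forall Q, KYP_solution K Sys Q ->
         storage_function K Sys (quadratic_storage Sys Q)),
      (exists Q, KYP_solution K Sys Q /\ Q \in unitmx) -> pH K Sys
    & passive K Sys -> ds_E Sys \in unitmx -> KYP K Sys].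
Proof.
split; [split | split | | ].
- by move=> [Q /pH_with_KYP hQ]; exists Q.
- move=> [Q hQ]; split; first exact: KYP_positive_real hreg hQ.
  exists Q; split; last exact: KYP_storage hQ.
  by case: Sys hQ {hK hreg} => ? ? ? ? ? [].
- exact: pH_with_KYP.
- exact: KYP_storage.
- by move=> [Q [hQ uQ]]; exists Q; exact: KYP_solution_pH_with.
- exact: passive_KYP.
Qed.
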